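(* Let $\tau\in\mathbb{N}$ and let $\mathbf X=\{X_m\}_{m\in\mathbb{N}_0}$ be a dt-ss-csi($\tau$) process such that the distribution of $X_1$ is nondegenerate, with scaling function $b:\mathbb{N}\to(0,\infty)$. Then $b$ must be one of the following: (1) $b(n)=1$ for all $n\in\mathbb{N}$. (2) There exist a unique prime $p$ and $H>0$ such that $b(n)=(|n|_p)^H$ for all $n\in\mathbb{N}$. In other words, $b(p)<1$ and $b(q)=1$ for every prime $q\neq p$. (3) There exists $H>0$ such that $b(n)=n^H$ for all $n\in\mathbb{N}$. Conversely, for any completely multiplicative function $b:\mathbb{N}\to(0,\infty)$ satisfying one of the conditions (1), (2), (3), there exists a non-trivial dt-ss-si process having $b$ as its scaling function.
   Context: $\mathbb{N}=\{1,2,\dots\}$, $\mathbb{N}_0=\{0,1,2,\dots\}$, and $\overset{d}{=}$ denotes equality in distribution. For a prime $p$ and $n\in\mathbb N$, $|n|_p=p^{-v_p(n)}$ is the $p$-adic norm, where $v_p(n)$ is the exponent of $p$ in $n$. A function $b:\mathbb N\to(0,\infty)$ is completely multiplicative if $b(mn)=b(m)b(n)$ for all $m,n\in\mathbb N$. All processes are real-valued. A process $\{X_m\}_{m\in\mathbb{N}_0}$ is marginally self-similar with scaling function $b:\mathbb{N}\to(0,\infty)$ if $X_{nm}\overset{d}{=}b(n)X_m$ for every $m\in\mathbb{N}_0$ and $n\in\mathbb{N}$. It has marginally cyclostationary increments with period $\tau\in\mathbb{N}$ if $X_{m+1}-X_m\overset{d}{=}X_{m+k\tau+1}-X_{m+k\tau}$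 for all $k,m\in\mathbb{N}_0$. A process with both properties is called dt-ss-csi($\tau$). A process $\{X_m\}_{m\in\mathbb{N}_0}$ is dt-ss-si with scaling function $b:\mathbb N\to(0,\infty)$ if, as processes, $\{X_{nm}\}_{m\in\mathbb{N}_0}\overset{d}{=}\{b(n)X_m\}_{m\in\mathbb{N}_0}$ for every $n\in\mathbb{N}$, and $\{X_{m+1}-X_m\}_{m\in\mathbb{N}_0}\overset{d}{=}\{X_{m+k+1}-X_{m+k}\}_{m\in\mathbb{N}_0}$ for every $k\in\mathbb{N}$. Non-trivial means that it is not the case $\mathbf X\equiv 0$. *)

(* Defs.v *)
From mathcomp Require Export all_boot all_order all_algebra.
From mathcomp Require Export all_classical all_reals all_analysis.
Export Order.TTheory GRing.Theory Num.Theory.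
Export numFieldNormedType.Exports.

Set Implicit Arguments.
Unset Strict Implicit.
Unset Printing Implicit Defensive.

Local Open Scope classical_set_scope.
Local Open Scope ring_scope.

(* NN = {1, 2, ...} is encoded as the naturals n with (0 < n)%N; the value of a
   scaling function at 0 is never used. *)
Definition positive_valued (R : realType) (b : nat -> R) : Prop :=
  forall n, (0 < n)%N -> 0 < b n.

Definition completely_multiplicative (R : realType) (b : nat -> R) : Prop :=
  forall m n, (0 < m)%N -> (0 < n)%N -> b (m * n)%N = b m * b n.

(* For n > 0 and p prime, logn p n is the exponent of p in n. *)
Definition padic_norm (R : realType) (p n : nat) : R := p%:R ^- logn p n.

Section Processes.
Context {R : realType} {d : measure_display} {T : measurableType d}.
Variable P : probability T R.

Definition eq_dist (X Y : T -> R) : Prop :=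
  forall A : set R, measurable A -> P (X @^-1` A) = P (Y @^-1` A).

(* Equality of laws on the sequence space, equipped with the product
   sigma-algebra (generated by the coordinate maps). *)
Definition eq_dist_process (X Y : nat -> T -> R) : Prop :=
  forall A : set (nat -> R),
    <<s \bigcup_m preimage_set_system setT (fun x : nat -> R => x m) measurable >> A ->
    P [set w | A (X ^~ w)] = P [set w | A (Y ^~ w)].

Definition nondegenerate (X : {RV P >-> R}) : Prop :=
  ~ exists c : R, distribution P X [set c] = 1%E.

Variable X : nat -> {RV P >-> R}.

Definition marginally_self_similar (b : nat -> R) : Prop :=
  forall m n, (0 < n)%N -> eq_dist (X (n * m)%N) (fun w => b n * X m w).

Definition marginally_cyclostationary_increments (tau : nat) : Prop :=
  forall k m, eq_dist (fun w => X m.+1 w - X m w)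
                      (fun w => X (m + k * tau).+1 w - X (m + k * tau)%N w).

Definition dt_ss_csi (tau : nat) (b : nat -> R) : Prop :=
  marginally_self_similar b /\ marginally_cyclostationary_increments tau.

Definition self_similar (b : nat -> R) : Prop :=
  forall n, (0 < n)%N ->
    eq_dist_process (fun m => X (n * m)%N) (fun m w => b n * X m w).

Definition stationary_increments : Prop :=
  forall k, (0 < k)%N ->
    eq_dist_process (fun m w => X m.+1 w - X m w)
                    (fun m w => X (m + k).+1 w - X (m + k)%N w).

Definition dt_ss_si (b : nat -> R) : Prop :=
  self_similar b /\ stationary_increments.

(* X == 0 is understood up to almost sure equality. *)
Definition nontrivial : Prop := ~ {ae P, forall w, forall m, X m w = 0}.

End Processes.

Definition scaling_one (R : realType) (b : nat -> R) : Prop :=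
  forall n, (0 < n)%N -> b n = 1.

Definition padic_scaling (R : realType) (b : nat -> R) (p : nat) : Prop :=
  exists H : R, 0 < H /\ forall n, (0 < n)%N -> b n = padic_norm R p n `^ H.

Definition scaling_padic (R : realType) (b : nat -> R) : Prop :=
  exists! p : nat, prime p /\ padic_scaling b p.

Definition scaling_power (R : realType) (b : nat -> R) : Prop :=
  exists H : R, 0 < H /\ forall n, (0 < n)%N -> b n = n%:R `^ H.

(* Main.v *)
(* Necessity. Write f for the tail of |X_1|, so that |X_m| has tail f(t / b(m)).
   The increments have only tau distinct laws, hence are uniformly tight.

   If b(q) > 1 for some q, tightness gives b(m + 1) / b(m) -> 1 as b(m) -> oo.
   Appending base q digits to a suitable a then shows that b(n) is within a
   factor (1 + eps)^k of b(q)^k b(a) for all n in [a q^k, (a + 1) q^k). Every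
   power r^j has a bounded multiple in such a block, which forces
   ln b(r) / ln r = ln b(q) / ln q.

   If b <= 1 and b(p) < 1, then X_(m + 1) - X_m vanishes almost surely whenever
   some m' = m mod tau makes both b(m') and b(m' + 1) arbitrarily small. Together
   with X_0 = 0 this gives b(n) = 1 for n coprime to p tau. For two primes p, q
   with b(p), b(q) < 1, take m divisible by p^L and m + 1 = q^c t with c the
   valuation of tau at q and t coprime to p tau: the increment at m vanishes, yet
   b(m + 1) = b(q)^c while b(m) -> 0 as L -> oo, a contradiction.

   Existence. Let g be the 1-periodic indicator of [1/2, 1) and let all the xi's
   and phi's be independent and uniform on the circle. With r = p^(-H),
     X_m = sum_(k >= 0) r^k (g(xi_(k, m mod p^k)) - g(xi_(k, 0)))
   is the p-adic example: i |-> n i + j acts on the indices by injections. With U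
   uniform on [0, 1),
     X_m = sum_(k in Z) e^(H (k + U)) (g(m e^(-(k + U)) + phi_k) - g(phi_k))
   has scaling n^H, for every H > 0: translations rotate the phi's, dilation by n
   rotates U by ln n and relabels k. The terms are geometrically small as
   k -> -oo and, by Borel-Cantelli, eventually zero as k -> +oo. *)
Require Import Defs.
From HB Require Import structures.
From mathcomp Require Import ring lra zify measurable_realfun.

Set Implicit Arguments.
Unset Strict Implicit.
Unset Printing Implicit Defensive.

Local Open Scope classical_set_scope.
Local Open Scope ring_scope.

(** * Completely multiplicative functions *)

Lemma eq_on_primes (R : realType) (b c : nat -> R) : completely_multiplicative b ->
  completely_multiplicative c -> b 1%N = c 1%N -> (forall p, prime p -> b p = c p) ->
  forall n, (0 < n)%N -> b n = c n.
Proof.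
move=> bM cM bc1 bcp; elim/ltn_ind => n IH n0.
have [n1|n1] := leqP n 1; first by have -> : n = 1%N by apply/eqP; rewrite eqn_leq n1.
have pn := pdiv_prime n1; rewrite -(divnK (pdiv_dvd n)).
have d0 : (0 < n %/ pdiv n)%N by rewrite divn_gt0 ?pdiv_gt0// pdiv_leq.
by rewrite bM ?cM ?pdiv_gt0// (bcp _ pn) IH// ltn_Pdiv// prime_gt1.
Qed.

Lemma scaling_at_one (R : realType) (b : nat -> R) :
  positive_valued b -> completely_multiplicative b -> b 1%N = 1.
Proof.
move=> b0 bM; have := bM 1%N 1%N isT isT; rewrite mul1n.
by rewrite -{1}[b 1%N]mulr1 => /mulfI <- //; rewrite gt_eqF ?b0.
Qed.

Lemma padic_norm_powR (R : realType) (p n : nat) (H : R) :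
  padic_norm R p n `^ H = (p%:R^-1 `^ H) ^+ logn p n.
Proof.
by rewrite /padic_norm -exprVn -powR_mulrn ?invr_ge0// powRAC powR_mulrn ?powR_ge0.
Qed.

Lemma padic_scalingP (R : realType) (b : nat -> R) (p : nat) :
  positive_valued b -> completely_multiplicative b -> prime p ->
  padic_scaling b p <->
  b p < 1 /\ (forall q : nat, prime q -> q <> p -> b q = 1).
Proof.
move=> b0 bM pp; have p1 : 1 < p%:R :> R by rewrite ltr1n prime_gt1.
have p0 : 0 < p%:R :> R by exact: lt_trans p1.
have lnp : 0 < ln p%:R :> R by rewrite ln_gt0.
split=> [[H [H0 bE]]|[bp bq]].
  split=> [|q pq qp]; rewrite bE ?prime_gt0// padic_norm_powR.
    rewrite logn_prime// eqxx expr1 /powR invr_eq0 gt_eqF// -[ltRHS]expR0 ltr_expR.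
    by rewrite lnV ?posrE// mulrN oppr_lt0 mulr_gt0.
  by rewrite logn_prime// (introF eqP) ?expr0//; exact/nesym.
have bp0 := b0 _ (prime_gt0 pp).
(* This [H] solves [b p = p^(-H)]; it is positive because [0 < b p < 1]. *)
exists (- ln (b p) / ln p%:R); split; first by rewrite divr_gt0// oppr_gt0 ln_lt0// bp0.
set H := - _ / _; have bpE : b p = p%:R^-1 `^ H.
  by rewrite /powR invr_eq0 gt_eqF// lnV ?posrE// mulrN /H divfK ?gt_eqF// opprK lnK.
move=> n n0; rewrite padic_norm_powR -bpE.
apply: (eq_on_primes bM (c := fun n => b p ^+ logn p n)) => //.
- by move=> u v u0 v0; rewrite lognM// exprD.
- by rewrite logn1 scaling_at_one.
move=> q pq; rewrite logn_prime//; case: eqVneq => [->|/eqP qp]; first by rewrite expr1.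
by rewrite expr0 bq//; exact/nesym.
Qed.

(** * The trichotomy for scaling functions *)

Lemma bernoulli_ineq (R : realType) (x : R) (n : nat) :
  0 <= x -> 1 + n%:R * x <= (1 + x) ^+ n.
Proof.
move=> x0; elim: n => [|n IH]; first by rewrite mul0r addr0 expr0.
rewrite exprS -natr1; apply: (@le_trans _ _ ((1 + x) * (1 + n%:R * x))).
  have : 0 <= n%:R * x * x by rewrite !mulr_ge0.
  by nra.
by rewrite ler_wpM2l// addr_ge0.
Qed.

Lemma expr_unbounded (R : realType) (x A : R) : 1 < x -> exists n, A <= x ^+ n.
Proof.
move=> x1; have x10 : 0 < x - 1 by rewrite subr_gt0.
exists (Num.Def.archi_bound (`|A| / (x - 1))).
set n := Num.Def.archi_bound _.
have : `|A| / (x - 1) < n%:R.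
  by apply: archi_boundP; rewrite divr_ge0// ltW.
rewrite ltr_pdivrMr// => An.
have := @bernoulli_ineq R (x - 1) n (ltW x10); rewrite subrKC.
by move=> h; have := ler_norm A; lra.
Qed.

Lemma expr_arb_small (R : realType) (x A : R) : 0 < x < 1 -> 0 < A ->
  exists n, x ^+ n <= A.
Proof.
move=> /andP[x0 x1] A0; have [|n] := @expr_unbounded R x^-1 A^-1.
  by rewrite invf_gt1.
by rewrite exprVn lef_pV2 ?posrE ?exprn_gt0// => An; exists n.
Qed.

(** * Rescalings of a tail function *)

Section TailFunction.
Variables (R : realType) (f : R -> R).
Hypothesis f_noninc : forall s t, s <= t -> f t <= f s.
Hypothesis f_cvg0 : forall e, 0 < e -> exists2 T, 0 < T & f T <= e.
Hypothesis f_pos : exists2 t, 0 < t & 0 < f t.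

(** Otherwise [f v <= f (l v)] for all [v > 0], and iterating from a point where [f] is positive
    contradicts the decay to 0. *)
Lemma tail_strict_drop (l : R) : 1 < l -> exists2 v, 0 < v & f (l * v) < f v.
Proof.
move=> l1; apply: contrapT => H.
have step v : 0 < v -> f v <= f (l * v).
  by move=> v0; rewrite leNgt; apply/negP => h; apply: H; exists v.
have [t t0 ft] := f_pos.
have it n : f t <= f (l ^+ n * t).
  elim: n => [|n IH]; first by rewrite mul1r.
  rewrite (le_trans IH)// exprS -mulrA step// mulr_gt0// exprn_gt0//; lra.
have [T T0 fT] := @f_cvg0 (f t / 2) (divr_gt0 ft (ltr0Sn _ _)).
have [n Tn] := @expr_unbounded R l (T / t) l1.
have := it n; have : f (l ^+ n * t) <= f T.
  by apply: f_noninc; rewrite -ler_pdivrMr.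
lra.
Qed.

(** Two different scales would make [f] invariant under their ratio, which [tail_strict_drop]
    excludes. *)
Lemma tail_scale_inj (a c : R) : 0 < a -> 0 < c ->
  (forall t, f (t / a) = f (t / c)) -> a = c.
Proof.
suff main (x y : R) : 0 < x -> x < y -> ~ forall t, f (t / x) = f (t / y).
  move=> a0 c0 H; have [ac|ca|//] := ltgtP a c; exfalso.
    exact: (main _ _ a0 ac).
  by apply: (main _ _ c0 ca) => t; rewrite H.
move=> x0 xy; have y0 := lt_trans x0 xy.
have [|v v0] := @tail_strict_drop (y / x); first by rewrite ltr_pdivlMr ?mul1r.
move=> + H; have := H (v * y); rewrite mulfK ?gt_eqF//.
have -> : v * y / x = y / x * v by rewrite -mulrA mulrC.
by move=> ->; rewrite ltxx.
Qed.

(* If [X/x] and [Y/y] have the tail [f], and [X] lies within a tight distance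
   of [Y], then large [x] forces [y] to be nearly as large as [x]. *)
Lemma tail_scale_comparable (l : R) : 1 < l ->
  exists2 e, 0 < e & forall T, 0 < T ->
  exists2 M, 0 < M & forall x y, 0 < y -> M <= x ->
  (forall s, 0 <= s -> f ((s + T) / x) <= f (s / y) + e) -> x < l * y.
Proof.
move=> l1.
(* With [k] strictly between 1 and [l], [f] drops strictly from some [v] to [k v]. Half of this drop
   serves as [e], and the room between [k] and [l] absorbs [T] once [x] is large. *)
pose k := (1 + l) / 2; have [k1 kl] : 1 < k /\ k < l by rewrite /k; split; lra.
have k0 : 0 < k by lra.
have [v v0 fv] := tail_strict_drop k1.
exists ((f v - f (k * v)) / 2); first by rewrite divr_gt0// subr_gt0.
move=> T T0.
have d0 : 0 < v - v * k / l.
  by rewrite subr_gt0 ltr_pdivrMr ?ltr_pM2l//; lra.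
(* For [x] beyond this bound, [s = v k x / l] satisfies [(s + T) / x <= v]. If [l y <= x], then also
   [s / y >= k v], and the assumed inequality would give [f v <= f (k v) + e]. *)
exists (T / (v - v * k / l)); first exact: divr_gt0.
move=> x y y0 Mx H; have x0 : 0 < x by apply: lt_le_trans Mx; exact: divr_gt0.
rewrite ltNge; apply/negP => lyx.
have s0 : 0 <= v * k / l * x by rewrite !mulr_ge0 ?invr_ge0//; lra.
have := H _ s0.
have : f (v * k / l * x / y) <= f (k * v).
  apply: f_noninc; rewrite ler_pdivlMr//.
  have -> : v * k / l * x = k * v * (x / l) by ring.
  rewrite ler_pM2l; last exact: mulr_gt0.
  by rewrite ler_pdivlMr; lra.
have : f v <= f ((v * k / l * x + T) / x).
  apply: f_noninc; rewrite ler_pdivrMr//.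
  by move: Mx; rewrite ler_pdivrMr// => Mx; lra.
lra.
Qed.

End TailFunction.

Lemma natmul_bounded_le0 (R : realType) (x C : R) :
  (forall j : nat, j%:R * x <= C) -> x <= 0.
Proof.
move=> H; rewrite leNgt; apply/negP => x0.
have := H (Num.Def.archi_bound (`|C| / x)).
have : `|C| / x < (Num.Def.archi_bound (`|C| / x))%:R.
  by apply: archi_boundP; rewrite divr_ge0// ltW.
by rewrite ltr_pdivrMr// => h1 h2; have := ler_norm C; lra.
Qed.

Section Trichotomy.
(** [N m] stands for the tail of [|X_m|] and [G m] for that of [|X_(m + 1) - X_m|]. The last three
    hypotheses are the union bounds coming from the triangle inequality. *)
Variables (R : realType) (b : nat -> R) (N G : nat -> R -> R) (tau : nat).
Hypothesis tau_gt0 : (0 < tau)%N.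
Hypothesis b_gt0 : positive_valued b.
Hypothesis N_scale : forall m n t, (0 < n)%N -> N (n * m)%N t = N m (t / b n).
Hypothesis N_noninc : forall m s t, s <= t -> N m t <= N m s.
Hypothesis N_ge0 : forall m t, 0 <= N m t.
Hypothesis N_cvg0 : forall m (e : R), 0 < e -> exists2 T : R, 0 < T & N m T <= e.
Hypothesis N1_pos : exists2 t : R, 0 < t & 0 < N 1%N t.
Hypothesis G_periodic : forall k m t, G (m + k * tau)%N t = G m t.
Hypothesis G_noninc : forall m s t, s <= t -> G m t <= G m s.
Hypothesis G_ge0 : forall m t, 0 <= G m t.
Hypothesis G_cvg0 : forall m (e : R), 0 < e -> exists2 T : R, 0 < T & G m T <= e.
Hypothesis G_le : forall m s t, G m (s + t) <= N m.+1 s + N m t.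
Hypothesis NS_le : forall m s t, N m.+1 (s + t) <= N m s + G m t.
Hypothesis N_le : forall m s t, N m (s + t) <= N m.+1 s + G m t.

Let N_E m t : (0 < m)%N -> N m t = N 1%N (t / b m).
Proof. by move=> m0; rewrite -(N_scale _ _ m0) muln1. Qed.

(** The tail of [X_(mn)] is that of [X_1] rescaled both by [b (m n)] and by [b m * b n], and a tail
    that is not zero determines its scale. *)
Lemma scaling_mul : completely_multiplicative b.
Proof.
move=> m n m0 n0; apply: (tail_scale_inj (@N_noninc 1%N) (@N_cvg0 1%N) N1_pos).
- by apply: b_gt0; rewrite muln_gt0 m0.
- by rewrite mulr_gt0 ?b_gt0.
move=> t; rewrite -N_E ?muln_gt0 ?m0// N_scale// N_E//.
by congr N; rewrite invfM mulrA.
Qed.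

Let scaling1 : b 1%N = 1.
Proof. exact: scaling_at_one b_gt0 scaling_mul. Qed.

Lemma scalingX n k : (0 < n)%N -> b (n ^ k)%N = b n ^+ k.
Proof.
move=> n0; elim: k => [|k IH]; first by rewrite expn0 scaling1.
by rewrite expnS scaling_mul ?expn_gt0 ?n0// IH exprS.
Qed.

Lemma G_uniformly_tight (e : R) :
  0 < e -> exists2 T : R, 0 < T & forall m, G m T <= e.
Proof.
move=> e0; suff [T T0 HT] : exists2 T : R, 0 < T & forall m, (m < tau)%N -> G m T <= e.
  by exists T => // m; rewrite (divn_eq m tau) addnC G_periodic HT ?ltn_mod.
elim: tau => [|n [T T0 HT]]; first by exists 1.
have [T' T'0 HT'] := G_cvg0 n e0; exists (Num.max T T').
  by rewrite lt_max T0.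
move=> m; rewrite ltnS leq_eqVlt => /predU1P[->|mn].
  by apply: le_trans HT'; apply: G_noninc; rewrite le_max lexx orbT.
by apply: le_trans (HT m mn); apply: G_noninc; rewrite le_max lexx.
Qed.

Lemma scaling_slowly_varying (l : R) : 1 < l -> exists2 M, 0 < M &
  forall m, (0 < m)%N -> M <= b m -> b m < l * b m.+1 /\ b m.+1 < l * b m.
Proof.
move=> l1; have [e e0] := tail_scale_comparable (@N_noninc 1%N) (@N_cvg0 1%N) N1_pos l1.
have [T T0 HT] := G_uniformly_tight e0.
move=> /(_ T T0)[M M0 HM]; exists M => // m m0 Mm; split.
  apply: HM => //; first exact: b_gt0.
  by move=> s _; rewrite -!N_E// (le_trans (N_le _ _ _))// lerD2l.
(* The comparison requires the scale [b (m + 1)] to be at least [M]; if it is smaller, it is already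
   below [b m]. *)
have [Mm1|Mm1] := leP M (b m.+1); last first.
  by apply: (lt_le_trans Mm1); rewrite (le_trans Mm)// ler_peMl ?ltW ?b_gt0.
apply: HM => //; first exact: b_gt0.
by move=> s _; rewrite -!N_E// (le_trans (NS_le _ _ _))// lerD2l.
Qed.

(** * Scaling functions that exceed 1: growth along base [q] digits *)

Section UnboundedScaling.
Variables (q : nat).
Hypotheses (q_gt0 : (0 < q)%N) (bq_gt1 : 1 < b q).

(** Appending the digit [r] is a multiplication by [q] followed by [r] unit steps, each costing a
    factor at most [l]. As [l^q <= b q], the loss never exceeds the gain, so the value stays above
    [M] and the next step is allowed. *)
Lemma scaling_digit_step (l M : R) (c r : nat) : 1 < l -> l ^+ q <= b q ->
  (forall m, (0 < m)%N -> M <= b m -> b m < l * b m.+1 /\ b m.+1 < l * b m) ->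
  (0 < c)%N -> 0 < M -> M <= b c -> (r < q)%N ->
  [/\ M <= b (q * c + r)%N, b q * b c <= l ^+ r * b (q * c + r)%N
    & b (q * c + r)%N <= l ^+ r * (b q * b c)].
Proof.
move=> l1 lq HM c0 M0 Mc; have l0 : 0 < l by lra.
elim: r => [|r IH] rq.
  rewrite addn0 scaling_mul// !mul1r; split => //.
  by rewrite (le_trans Mc)// ler_peMl ?ltW ?b_gt0.
have {IH}[M' lo hi] := IH (ltnW rq).
have n0 : (0 < q * c + r)%N by rewrite addn_gt0 muln_gt0 q_gt0 c0.
have [h1 h2] := HM _ n0 M'.
have lo' : b q * b c <= l ^+ r.+1 * b (q * c + r.+1)%N.
  rewrite (le_trans lo)// exprSr -mulrA ler_pM2l ?exprn_gt0// addnS.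
  exact: ltW.
rewrite addnS in lo' *; split => //; last first.
  by rewrite (le_trans (ltW h2))// exprS -mulrA ler_pM2l//.
have lrq : l ^+ r.+1 <= l ^+ q by apply: ler_weXn2l; [exact: ltW|exact: ltnW].
rewrite (le_trans Mc)// -(ler_pM2l (b_gt0 q_gt0)) (le_trans lo')// ler_pM2r ?b_gt0//.
exact: le_trans lq.
Qed.

(** The number [a] is a power of [q] with [b a] large, to which [k] base [q] digits are appended.
    With [l = exp (d / q)] each digit costs a factor at most [l^q = exp d], whence the error [k d]
    in the logarithm. *)
Lemma scaling_growth (d : R) : 0 < d <= ln (b q) -> exists2 a, (0 < a)%N &
  forall k r, (r < q ^ k)%N ->
    k%:R * (ln (b q) - d) + ln (b a) <= ln (b (a * q ^ k + r)%N)
      <= k%:R * (ln (b q) + d) + ln (b a).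
Proof.
move=> /andP[d0 dq]; pose l := expR (d / q%:R).
have bq0 : 0 < b q by exact: b_gt0.
have qR0 : 0 < q%:R :> R by rewrite ltr0n.
have l1 : 1 < l by rewrite expR_gt1 divr_gt0.
have lqE : l ^+ q = expR d by rewrite -expRM_natl mulrC divfK ?gt_eqF.
have lq : l ^+ q <= b q by rewrite lqE -[leRHS]lnK ?posrE// ler_expR.
have [M M0 HM] := scaling_slowly_varying l1.
have [n Mn] := expr_unbounded M bq_gt1.
exists (q ^ n)%N; first by rewrite expn_gt0 q_gt0.
set a := (q ^ n)%N; have a0 : (0 < a)%N by rewrite expn_gt0 q_gt0.
have Ma : M <= b a by rewrite scalingX.
move=> k r rk.
(* The induction carries the bound by [M], without which no further digit can be appended. *)
suff [] : M <= b (a * q ^ k + r)%N /\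
    k%:R * (ln (b q) - d) + ln (b a) <= ln (b (a * q ^ k + r)%N)
      <= k%:R * (ln (b q) + d) + ln (b a) by [].
elim: k r rk => [|k IH] r.
  by rewrite expn0 ltnS leqn0 => /eqP->; rewrite addn0 muln1 !mul0r !add0r lexx.
move=> rk; pose r1 := (r %/ q)%N; pose r0 := (r %% q)%N.
have r1k : (r1 < q ^ k)%N by rewrite ltn_divLR// -expnSr.
have r0q : (r0 < q)%N by rewrite ltn_mod.
have {IH}[M1 /andP[lo hi]] := IH _ r1k.
pose c := (a * q ^ k + r1)%N.
have c0 : (0 < c)%N by rewrite addn_gt0 muln_gt0 a0 expn_gt0 q_gt0.
have -> : (a * q ^ k.+1 + r = q * c + r0)%N.
  by rewrite {1}(divn_eq r q) -/r1 -/r0 expnS /c; ring.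
have [M' lo' hi'] := scaling_digit_step l1 lq HM c0 M0 M1 r0q.
split => //.
have n0 : (0 < q * c + r0)%N by rewrite addn_gt0 muln_gt0 q_gt0 c0.
have lr : l ^+ r0 <= expR d by rewrite -lqE; apply: ler_weXn2l; [exact: ltW|exact: ltnW].
have bc0 := b_gt0 c0; have bn0 := b_gt0 n0.
have {}lo' : ln (b q) + ln (b c) <= d + ln (b (q * c + r0)%N).
  rewrite -[d]expRK -!lnM ?posrE ?expR_gt0// ler_ln ?posrE ?mulr_gt0 ?expR_gt0//.
  by rewrite (le_trans lo')// ler_pM2r.
have {}hi' : ln (b (q * c + r0)%N) <= d + (ln (b q) + ln (b c)).
  rewrite -[d]expRK -!lnM ?posrE ?expR_gt0 ?mulr_gt0//.
  rewrite ler_ln ?posrE ?mulr_gt0 ?expR_gt0//.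
  by rewrite (le_trans hi')// ler_pM2r// mulr_gt0.
by rewrite -natr1 !mulrDl !mul1r; apply/andP; split; move: lo hi; rewrite -/c; lra.
Qed.

Let q_gt1 : (1 < q)%N.
Proof.
by rewrite ltn_neqAle q_gt0 andbT; apply/eqP => q1; move: bq_gt1; rewrite -q1 scaling1 ltxx.
Qed.

(* Every power [r ^ j] has a multiple by a bounded factor in the block
   [a q^k, (a + 1) q^k) controlled by scaling_growth. *)
Lemma scaling_power_growth (d : R) (r : nat) : (1 < r)%N -> 0 < d <= ln (b q) ->
  exists C : R, forall j, exists2 k : nat,
    j%:R * @ln R r%:R <= k%:R * @ln R q%:R <= j%:R * @ln R r%:R + @ln R q%:R &
    k%:R * (ln (b q) - d) - C <= j%:R * ln (b r) <= k%:R * (ln (b q) + d) + C.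
Proof.
move=> r1 dq; have [a a0 Ha] := scaling_growth dq.
have r0 : (0 < r)%N by exact: ltnW.
(* The multiplier [c] below is at most [a q], so this sum bounds [|ln (b c)|] uniformly in [j]. *)
pose C0 : R := \sum_(c < (a * q + 1)%N) `|ln (b c)|.
exists (C0 + `|ln (b a)|) => j.
(* The least [k] with [r^j <= q^k]; then [q^k <= q r^j]. *)
pose k := up_log q (r ^ j).
have rj0 : (0 < r ^ j)%N by rewrite expn_gt0 r0.
have rk : (r ^ j <= q ^ k)%N by exact: up_logP.
have kr : (q ^ k <= q * r ^ j)%N.
  have [rj1|rj1] := ltnP 1 (r ^ j)%N.
    have k0 : (0 < k)%N by rewrite up_log_gt0 q_gt1.
    have := up_log_gtn q_gt1 rj1; rewrite -/k -{2}(prednK k0) expnS.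
    by rewrite leq_pmul2l// => /ltnW.
  have -> : k = 0%N by apply/eqP; rewrite up_log_eq0 rj1 orbT.
  by rewrite expn0 muln_gt0 q_gt0.
exists k.
  have -> : j%:R * ln r%:R = ln (r ^ j)%:R :> R.
    by rewrite natrX lnXn ?ltr0n// mulr_natl.
  have -> : k%:R * ln q%:R = ln (q ^ k)%:R :> R.
    by rewrite natrX lnXn ?ltr0n// mulr_natl.
  rewrite -lnM ?posrE ?ltr0n// -natrM.
  have qk0 : (0 < q ^ k)%N by rewrite expn_gt0 q_gt0.
  by rewrite !ler_ln ?posrE ?ltr0n ?muln_gt0 ?rj0 ?qk0// !ler_nat rk mulnC.
(* The ceiling of [a q^k / r^j]: the multiple [c r^j] overshoots [a q^k] by less than [r^j <= q^k],
   so it stays in the block. *)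
pose c := ((a * q ^ k + (r ^ j).-1) %/ r ^ j)%N.
have qk0 : (0 < q ^ k)%N by rewrite expn_gt0 q_gt0.
have lec : (a * q ^ k <= c * r ^ j)%N.
  have := ltn_ceil (a * q ^ k + (r ^ j).-1)%N rj0; rewrite -/c mulSn; lia.
have gec : (c * r ^ j <= a * q ^ k + (r ^ j).-1)%N by exact: leq_divM.
have c0 : (0 < c)%N.
  have h : (0 < a * q ^ k)%N by rewrite muln_gt0 a0.
  by move: (leq_trans h lec); rewrite muln_gt0 => /andP[].
have cC : (c < a * q + 1)%N.
  rewrite -(ltn_pmul2r rj0) mulnDl mul1n (leq_ltn_trans gec)//.
  rewrite -mulnA; have := leq_mul (leqnn a) kr; lia.
have := Ha k (c * r ^ j - a * q ^ k)%N; rewrite subnKC//.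
case/(_ _)/andP; first by lia.
rewrite scaling_mul// scalingX// lnM ?posrE ?exprn_gt0 ?b_gt0//.
rewrite lnXn ?b_gt0// -mulr_natl => lo hi.
have : `|ln (b c)| <= C0.
  by rewrite /C0 (bigD1 (Ordinal cC))//= lerDl sumr_ge0.
have := ler_norm (ln (b c)); have := ler_norm (- ln (b c)).
have := ler_norm (ln (b a)); have := ler_norm (- ln (b a)); rewrite !normrN.
by move=> *; apply/andP; split; lra.
Qed.

(** [natmul_bounded_le0] removes the bounded errors of [scaling_power_growth] as [j] grows. This
    squeezes [ln (b r) ln q] between [ln r (ln (b q) - d)] and [ln r (ln (b q) + d)] for arbitrarily
    small [d]. *)
Lemma unbounded_scaling_power : scaling_power b.
Proof.
have lq0 : 0 < ln (b q) by rewrite ln_gt0.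
have lnq0 : 0 < ln q%:R :> R by rewrite ln_gt0// ltr1n.
exists (ln (b q) / ln q%:R); split; first exact: divr_gt0.
move=> r; rewrite leq_eqVlt => /predU1P[<-|r1].
  by rewrite scaling1 powR1.
have lnr0 : 0 < ln r%:R :> R by rewrite ln_gt0// ltr1n.
have r0 : (0 < r)%N by exact: ltnW.
have hi d : 0 < d <= ln (b q) -> ln (b r) * ln q%:R <= ln r%:R * (ln (b q) + d).
  move=> dq; have /andP[d0 _] := dq; have [C HC] := scaling_power_growth r1 dq.
  rewrite -subr_le0; apply: (@natmul_bounded_le0 _ _
    (ln q%:R * (ln (b q) + d) + C * ln q%:R)) => j.
  have [k /andP[k1 k2] /andP[h1 h2]] := HC j.
  have := ler_wpM2r (ltW lnq0) h2.
  have : 0 <= ln (b q) + d by lra.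
  move/ler_wpM2r => /(_ _ _ k2); lra.
have lo d : 0 < d <= ln (b q) -> ln r%:R * (ln (b q) - d) <= ln (b r) * ln q%:R.
  move=> dq; have /andP[d0 dl] := dq; have [C HC] := scaling_power_growth r1 dq.
  rewrite -subr_le0; apply: (@natmul_bounded_le0 _ _ (C * ln q%:R)) => j.
  have [k /andP[k1 k2] /andP[h1 h2]] := HC j.
  have := ler_wpM2r (ltW lnq0) h1.
  have : 0 <= ln (b q) - d by lra.
  move/ler_wpM2r => /(_ _ _ k1); lra.
have E : ln (b r) * ln q%:R = ln r%:R * ln (b q).
  apply/eqP; rewrite eq_le; apply/andP; split; apply/ler_addgt0Pr => e e0.
    have := hi (Num.min (ln (b q)) (e / ln r%:R)).
    rewrite lt_min lq0 divr_gt0//= ge_min lexx => /(_ isT)/le_trans; apply.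
    rewrite mulrDr lerD2l -[leRHS](@divfK _ (ln r%:R)) ?gt_eqF// mulrC ler_pM2r//.
    by rewrite ge_min lexx orbT.
  have := lo (Num.min (ln (b q)) (e / ln r%:R)).
  rewrite lt_min lq0 divr_gt0//= ge_min lexx => /(_ isT).
  rewrite mulrBr lerBlDr => /le_trans; apply.
  rewrite lerD2l -[leRHS](@divfK _ (ln r%:R)) ?gt_eqF// mulrC ler_pM2r//.
  by rewrite ge_min lexx orbT.
rewrite /powR pnatr_eq0 gtn_eqF//.
have -> : ln (b q) / ln q%:R * ln r%:R = ln (b r).
  by rewrite mulrAC [ln (b q) * _]mulrC -E mulfK// gt_eqF.
by rewrite lnK// posrE b_gt0.
Qed.

End UnboundedScaling.

Lemma large_chinese (r s B x y : nat) : coprime x y -> (0 < x)%N -> (0 < y)%N ->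
  exists z, [/\ (B <= z)%N, z = r %[mod x] & z = s %[mod y]].
Proof.
move=> co x0 y0; have zr := chinese_modl co r s; have zs := chinese_modr co r s.
move: (chinese x y r s) zr zs => z zr zs; exists (B * (x * y) + z)%N; split.
- by rewrite (leq_trans (leq_pmulr B _) (leq_addr _ _))// muln_gt0 x0.
- by rewrite [(x * y)%N]mulnC mulnA modnMDl.
- by rewrite mulnA modnMDl.
Qed.

(** * Scaling functions bounded by 1: vanishing increments and congruences *)

Section BoundedScaling.
Hypothesis b_le1 : forall n, (0 < n)%N -> b n <= 1.

(** Since [b <= 1], a multiple of [x^l] has scale at most [b(x)^l], so its tail at [t] is at most
    the tail of [X_1] at a level as high as desired. *)
Lemma N_small (x : nat) (t e : R) : (0 < x)%N -> b x < 1 -> 0 < t -> 0 < e ->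
  exists l, forall m, (0 < m)%N -> (x ^ l %| m)%N -> N m t <= e.
Proof.
move=> x0 bx t0 e0; have [T T0 HT] := N_cvg0 1%N e0.
have [||l Hl] := @expr_arb_small R (b x) (t / T); rewrite ?divr_gt0 ?b_gt0//.
exists l => m m0 /dvdnP[k mE]; have k0 : (0 < k)%N.
  by move: m0; rewrite mE muln_gt0 => /andP[].
rewrite N_E// (le_trans _ HT)// N_noninc// ler_pdivlMr ?b_gt0//.
rewrite mulrC -ler_pdivlMr// (le_trans _ Hl)// mE scaling_mul ?expn_gt0 ?x0//.
by rewrite scalingX// ler_piMl ?b_le1// exprn_ge0// ltW// b_gt0.
Qed.

(** [X_0] has the same tail as [b(x)^l X_0] for every [l], and [b(x)^l] tends to 0. *)
Lemma N0_eq0 (x : nat) (t : R) : (0 < x)%N -> b x < 1 -> 0 < t -> N 0 t = 0.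
Proof.
move=> x0 bx t0; apply/eqP; rewrite eq_le N_ge0 andbT; apply/ler_addgt0Pr => e e0.
rewrite add0r; have [T T0 HT] := N_cvg0 0%N e0.
have [||l Hl] := @expr_arb_small R (b x) (t / T); rewrite ?divr_gt0 ?b_gt0//.
have xl0 : (0 < x ^ l)%N by rewrite expn_gt0 x0.
have := @N_scale 0%N (x ^ l)%N t xl0; rewrite muln0 => ->.
rewrite (le_trans _ HT)// N_noninc// ler_pdivlMr ?b_gt0//.
by rewrite mulrC -ler_pdivlMr// scalingX.
Qed.

(** Periodicity moves the increment at [m] to [m + k tau], where both endpoints are small in
    probability. *)
Lemma G_eq0 (x y m : nat) (t : R) : (0 < x)%N -> (0 < y)%N -> b x < 1 -> b y < 1 ->
  (forall l, exists k, [/\ (0 < m + k * tau)%N, (x ^ l %| m + k * tau)%N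
                         & (y ^ l %| (m + k * tau).+1)%N]) ->
  0 < t -> G m t = 0.
Proof.
move=> x0 y0 bx by1 H t0; apply/eqP; rewrite eq_le G_ge0 andbT.
apply/ler_addgt0Pr => e e0; rewrite add0r.
have t2 : 0 < t / 2 by rewrite divr_gt0.
have e2 : 0 < e / 2 by rewrite divr_gt0.
have [l1 H1] := N_small x0 bx t2 e2.
have [l2 H2] := N_small y0 by1 t2 e2.
have [k [k0 xk yk]] := H (maxn l1 l2).
rewrite -(G_periodic k) (splitr t) (le_trans (G_le _ _ _))// [leRHS]splitr lerD//.
  by apply: H2 => //; apply: dvdn_trans yk; rewrite dvdn_exp2l// leq_maxr.
by apply: H1 => //; apply: dvdn_trans xk; rewrite dvdn_exp2l// leq_maxl.
Qed.

(** If [b n < 1], the Chinese remainder theorem yields multiples of [tau] divisible by [p^l] whose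
    successors are divisible by [n^l]. So the increment at 0 vanishes, and with [X_0 = 0] this
    contradicts the nonzero tail of [X_1]. *)
Lemma scaling_coprime_eq1 (p n : nat) : prime p -> b p < 1 ->
  (0 < n)%N -> coprime n p -> coprime n tau -> b n = 1.
Proof.
move=> pp bp n0 np ntau; have p0 := prime_gt0 pp.
apply/eqP; rewrite eq_le b_le1//= leNgt; apply/negP => bn.
have [t t0 Nt] := N1_pos.
have := NS_le 0 (t / 2) (t / 2); rewrite -splitr (N0_eq0 p0 bp) ?divr_gt0//.
rewrite (@G_eq0 p n) ?divr_gt0// ?addr0 ?leNgt ?Nt// => l.
have co : coprime (p ^ l * tau) (n ^ l).
  by rewrite coprimeMl; apply/andP; split; rewrite coprime_sym;
    [apply: coprimeXl; apply: coprimeXr|apply: coprimeXl].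
have nl0 : (0 < n ^ l)%N by rewrite expn_gt0 n0.
have pl0 : (0 < p ^ l)%N by rewrite expn_gt0 p0.
have ptau0 : (0 < p ^ l * tau)%N by rewrite muln_gt0 pl0.
have [z [z0 zx zy]] := large_chinese 0 (n ^ l).-1 1 co ptau0 nl0.
have z1 : (p ^ l * tau %| z)%N by rewrite /dvdn zx mod0n.
have z2 : (n ^ l %| z.+1)%N by rewrite /dvdn -addn1 -modnDml zy modnDml addn1 prednK// modnn.
have taudvd : (tau %| z)%N by apply: dvdn_trans z1; rewrite dvdn_mull.
exists (z %/ tau)%N; rewrite add0n divnK//; split => //.
- by apply: dvdn_trans z1; rewrite dvdn_mulr.
Qed.

Lemma coprime_dvd_succ (x m : nat) : (x %| m)%N -> coprime x m.+1.
Proof. by move=> /dvdnP[k ->]; rewrite -addn1 /coprime gcdnMDl gcdn1. Qed.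

(** The new index [z] is chosen congruent to 0 mod [p^(l + a)], to -1 mod [q^(l + c)] and to [m] mod
    [rho]. By the divisibility of [m] and [m + 1], the difference [z - m] is a multiple of [p^a],
    [q^c] and [rho], hence of [tau]. *)
Lemma common_shift (p q a c rho m : nat) : prime p -> prime q -> p != q ->
  tau = (rho * q ^ c * p ^ a)%N -> coprime q rho -> coprime p rho -> (0 < m)%N ->
  (p ^ a %| m)%N -> (q ^ c %| m.+1)%N ->
  forall l, exists k, [/\ (0 < m + k * tau)%N, (p ^ l %| m + k * tau)%N
                        & (q ^ l %| (m + k * tau).+1)%N].
Proof.
move=> pp pq pneq tauE corq corp m0 pm qm l.
have copq u v : coprime (p ^ u) (q ^ v).
  by apply: coprimeXl; apply: coprimeXr; rewrite prime_coprime// dvdn_prime2.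
pose u := (l + a)%N; pose v := (l + c)%N.
have pu0 : (0 < p ^ u)%N by rewrite expn_gt0 prime_gt0.
have qv0 : (0 < q ^ v)%N by rewrite expn_gt0 prime_gt0.
have rho0 : (0 < rho)%N.
  by move: tau_gt0; rewrite tauE !muln_gt0 => /andP[/andP[]].
have cor : coprime (p ^ u * q ^ v) rho by rewrite coprimeMl !coprimeXl.
have [w [_ wp wq]] := large_chinese 0 (q ^ v).-1 0 (copq u v) pu0 qv0.
have puqv0 : (0 < p ^ u * q ^ v)%N by rewrite muln_gt0 pu0.
have [z [mz zw zr]] := large_chinese w m m cor puqv0 rho0.
have zp : (p ^ u %| z)%N.
  rewrite /dvdn -(@modn_dvdm (p ^ u * q ^ v)) ?dvdn_mulr// zw modn_dvdm ?dvdn_mulr//.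
  by rewrite wp mod0n.
have zq : (q ^ v %| z.+1)%N.
  rewrite /dvdn -addn1 -modnDml -(@modn_dvdm (p ^ u * q ^ v) z) ?dvdn_mull// zw.
  by rewrite modn_dvdm ?dvdn_mull// wq modnDml addn1 prednK// modnn.
have taud : (tau %| z - m)%N.
  rewrite tauE -mulnA Gauss_dvd; last by rewrite coprimeMr !coprimeXr// coprime_sym.
  rewrite Gauss_dvd ?copq; last by rewrite coprime_sym.
  rewrite -eqn_mod_dvd// zr eqxx/=; apply/andP; split.
    rewrite -subSS dvdn_sub//; apply: dvdn_trans zq.
    by rewrite dvdn_exp2l// leq_addl.
  by rewrite dvdn_sub//; apply: dvdn_trans zp; rewrite dvdn_exp2l// leq_addl.
exists ((z - m) %/ tau)%N; rewrite divnK// subnKC//; split.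
- exact: leq_trans mz.
- by apply: dvdn_trans zp; rewrite dvdn_exp2l// leq_addr.
- by apply: dvdn_trans zq; rewrite dvdn_exp2l// leq_addr.
Qed.

Lemma bounded_scaling_unique_prime (p q : nat) : prime p -> prime q -> p != q ->
  b p < 1 -> b q = 1.
Proof.
move=> pp pq pneq bp; have p0 := prime_gt0 pp; have q0 := prime_gt0 pq.
apply/eqP; rewrite eq_le b_le1//= leNgt; apply/negP => bq.
have copq : coprime p q by rewrite prime_coprime// dvdn_prime2.
have [sg cops tauE] := pfactor_coprime pp tau_gt0; move: (logn p tau) tauE => a tauE.
have sg0 : (0 < sg)%N by move: tau_gt0; rewrite tauE muln_gt0 => /andP[].
have [rho coqr sgE] := pfactor_coprime pq sg0; move: (logn q sg) sgE => c sgE.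
have copr : coprime p rho by move: cops; rewrite sgE coprimeMr => /andP[].
have qsg : (q %| sg)%N.
  apply/negPn/negP; rewrite -prime_coprime// => coqs.
  have := scaling_coprime_eq1 pp bp q0; rewrite tauE coprimeMr coqs coprime_sym copq.
  by rewrite coprimeXr 1?coprime_sym// => /(_ isT isT) bq1; rewrite bq1 ltxx in bq.
have [t t0 Nt] := N1_pos.
(* This will be [b (m + 1)], so that the tail of [X_(m + 1)] at [t be] is [N 1 t]; the level
   [t be / 2] is for the union bound. *)
pose be := b q ^+ c; have be0 : 0 < be by rewrite exprn_gt0 ?b_gt0.
have [||l Hl] := @N_small p (t * be / 2) (N 1 t / 2) p0 bp; rewrite ?divr_gt0 ?mulr_gt0//.
pose L := (l + a + 1)%N.
have pL0 : (0 < p ^ L)%N by rewrite expn_gt0 p0.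
have qc0 : (0 < q ^ c)%N by rewrite expn_gt0 q0.
have co : coprime (p ^ L) (sg * q ^ c) by rewrite coprimeXl// coprimeMr cops coprimeXr.
have sgq0 : (0 < sg * q ^ c)%N by rewrite muln_gt0 sg0.
(* [M] plays the role of [m + 1]. The first congruence makes [p^L] divide [m]; the second makes
   [M / q^c] congruent to 1 mod [sg], hence coprime to [sg]. *)
have [M [M2 M1 Mq]] := large_chinese 1 (q ^ c) 2 co pL0 sgq0.
pose m := M.-1; have mS : m.+1 = M by rewrite prednK// ltnW.
have m0 : (0 < m)%N by rewrite -ltnS mS.
have pm : (p ^ L %| m)%N by rewrite /m -subn1 -eqn_mod_dvd ?M1// ltnW.
have qM : (q ^ c %| M)%N.
  by rewrite /dvdn -(@modn_dvdm (sg * q ^ c)) ?dvdn_mull// Mq modn_dvdm ?dvdn_mull// modnn.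
pose tt := (M %/ q ^ c)%N; have ttE : M = (tt * q ^ c)%N by rewrite divnK.
have tt0 : (0 < tt)%N.
  by move: (ltnW M2); rewrite ttE muln_gt0 => /andP[].
have coptt : coprime tt p.
  have : coprime p M.
    by rewrite -mS coprime_dvd_succ// (dvdn_trans _ pm)// /L addn1 expnS dvdn_mulr.
  by rewrite ttE coprimeMr => /andP[]; rewrite coprime_sym.
have cosg : coprime tt sg.
  have : tt = 1 %[mod sg].
    apply/eqP; rewrite -(eqn_pmul2r qc0) !muln_modl// -ttE mul1n.
    exact/eqP.
  by move=> h; rewrite coprime_sym -coprime_modr h coprime_modr coprimen1.
have btt : b tt = 1.
  by apply: (scaling_coprime_eq1 pp) => //; rewrite tauE coprimeMr cosg coprimeXr.
have bM : b m.+1 = be by rewrite mS ttE scaling_mul// btt mul1r scalingX.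
have s0 : 0 < t * be / 2 by rewrite divr_gt0// mulr_gt0.
have Gm : G m (t * be / 2) = 0.
  have tauE' : tau = (rho * q ^ c * p ^ a)%N by rewrite -sgE.
  apply: (G_eq0 p0 q0) => //; apply: (common_shift pp pq pneq tauE' coqr copr m0).
  - by apply: dvdn_trans pm; rewrite dvdn_exp2l// /L addnAC leq_addl.
  - by rewrite mS.
(* The left side is [N 1 t], whereas the increment contributes nothing and [X_m] at most
   [N 1 t / 2]. *)
have := NS_le m (t * be / 2) (t * be / 2); rewrite Gm addr0 -splitr N_E// bM mulfK ?gt_eqF//.
have := Hl m m0; rewrite (dvdn_trans _ pm) => [/(_ isT)|]; first lra.
by rewrite dvdn_exp2l// /L -addnA leq_addr.
Qed.

End BoundedScaling.

Lemma scaling_trichotomy : [\/ scaling_one b, scaling_padic b | scaling_power b].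
Proof.
have [[q [q0 bq]]|H] := pselect (exists q, (0 < q)%N /\ 1 < b q).
  by apply: Or33; exact: (unbounded_scaling_power q0 bq).
have b_le1 n : (0 < n)%N -> b n <= 1.
  by move=> n0; rewrite leNgt; apply/negP => bn; apply: H; exists n.
have [[p [pp bp]]|H1] := pselect (exists p, prime p /\ b p < 1).
  have bq q : prime q -> q <> p -> b q = 1.
    move=> pq qp; apply: (bounded_scaling_unique_prime b_le1 pp pq _ bp).
    by apply/eqP; exact/nesym.
  apply: Or32; exists p; split.
    by split => //; apply/(padic_scalingP b_gt0 scaling_mul pp).
  move=> q [pq /(padic_scalingP b_gt0 scaling_mul pq)[bq1 _]].
  by apply: contrapT => pq'; move: bq1; rewrite bq ?ltxx//; exact/nesym.
apply: Or31 => n n0; apply: (eq_on_primes scaling_mul (c := fun=> 1)) => //.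
- by move=> u v _ _; rewrite mulr1.
move=> p pp; apply/eqP; rewrite eq_le b_le1 ?prime_gt0//= leNgt.
by apply/negP => bp; apply: H1; exists p.
Qed.

End Trichotomy.

(** * Tails of a self-similar process with cyclostationary increments *)

Section TailProbability.
Context {R : realType} {d : measure_display} {T : measurableType d}.
Variable P : probability T R.

Definition tail (Y : T -> R) (t : R) : R := fine (P [set w | t < `|Y w|]).

Let measurable_abs_gt (t : R) : measurable [set x : R | t < `|x|].
Proof.
rewrite (_ : [set x | _] = Num.Def.normr @^-1` `]t, +oo[%classic); last first.
  by apply/seteqP; split=> x /=; rewrite in_itv/= andbT.
by rewrite -[X in measurable X]setTI; exact: normr_measurable.
Qed.

Let measurable_tail (Y : T -> R) (t : R) : measurable_fun setT Y ->
  measurable [set w | t < `|Y w|].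
Proof. by move=> mY; have := mY measurableT _ (measurable_abs_gt t); rewrite setTI. Qed.

Lemma tail_ge0 (Y : T -> R) (t : R) : 0 <= tail Y t.
Proof. by rewrite fine_ge0. Qed.

Lemma tail_noninc (Y : T -> R) : measurable_fun setT Y ->
  forall s t : R, s <= t -> tail Y t <= tail Y s.
Proof.
move=> mY s t st; rewrite fine_le ?fin_num_measure//; [exact: measurable_tail..|].
apply: le_measure; rewrite ?inE; [exact: measurable_tail..|].
by move=> w /=; exact: le_lt_trans.
Qed.

Lemma tail_cvg0 (Y : T -> R) : measurable_fun setT Y ->
  forall e : R, 0 < e -> exists2 t : R, 0 < t & tail Y t <= e.
Proof.
move=> mY e e0; pose F (k : nat) := [set w | k%:R < `|Y w|].
have mF k : measurable (F k) by exact: measurable_tail.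
have F0 : \bigcap_k F k = set0.
  apply/seteqP; split=> // w Fw; have := Fw (Num.Def.archi_bound `|Y w|) I.
  by rewrite /F/= ltNge ltW// archi_boundP.
have : (P \o F) x @[x --> \oo] --> P (\bigcap_k F k).
  apply: nonincreasing_cvg_mu => //.
  - exact: (le_lt_trans (probability_le1 _ _) (ltry _)).
  - exact: bigcapT_measurable.
  - move=> m n mn; apply/subsetPset => w; rewrite /F/=; apply: le_lt_trans.
    by rewrite ler_nat.
rewrite F0 measure0 => /fine_cvgP[_ /cvgrPdist_le/(_ _ e0)[n _ Hn]].
exists n.+1%:R => //; have := Hn n.+1 (leqnSn _).
by rewrite /= sub0r normrN ger0_norm// fine_ge0.
Qed.

Lemma tail_le_add (Z Y Y' : T -> R) (s t : R) :
  measurable_fun setT Z -> measurable_fun setT Y ->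
  measurable_fun setT Y' -> (forall w, `|Z w| <= `|Y w| + `|Y' w|) ->
  tail Z (s + t) <= tail Y s + tail Y' t.
Proof.
move=> mZ mY mY' H; rewrite -fineD ?fin_num_measure//; try exact: measurable_tail.
rewrite fine_le ?fin_numD ?fin_num_measure//; try exact: measurable_tail.
apply: (@le_trans _ _ (P ([set w | s < `|Y w|] `|` [set w | t < `|Y' w|]))).
  apply: le_measure; rewrite ?inE; [exact: measurable_tail|
    by apply: measurableU; exact: measurable_tail|].
  move=> w /= Zw; have [sY|sY] := ltP s `|Y w|; first by left.
  by right; have := H w; rewrite /=; move: Zw sY; lra.
by apply: measureU2; exact: measurable_tail.
Qed.

Lemma tail_eq_dist (Y Y' : T -> R) : eq_dist P Y Y' -> tail Y = tail Y'.
Proof.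
by move=> H; apply/funext => t; congr fine; exact: (H _ (measurable_abs_gt t)).
Qed.

Lemma tail_scale (Y : T -> R) (a t : R) : 0 < a -> tail (fun w => a * Y w) t = tail Y (t / a).
Proof.
move=> a0; rewrite /tail; congr (fine (P _)); apply/seteqP; split=> w /=;
by rewrite normrM gtr0_norm// ltr_pdivrMr// mulrC.
Qed.

(** The event [Y <> 0] is the countable union of the events [|Y| > 1 / (k + 1)]; if all of these
    were null, [Y] would vanish almost surely. *)
Lemma tail_nonzero (Y : T -> R) : measurable_fun setT Y -> P (Y @^-1` [set 0]) != 1%E ->
  exists2 t, 0 < t & 0 < tail Y t.
Proof.
move=> mY /eqP h; apply: contrapT => H; apply: h.
have m0 : measurable (Y @^-1` [set 0]).
  by rewrite -[X in measurable X]setTI; exact: mY.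
have : P (~` (Y @^-1` [set 0])) = 0%E.
  have -> : ~` (Y @^-1` [set 0]) = \bigcup_k [set w | k.+1%:R^-1 < `|Y w|].
    apply/seteqP; split=> [w /= /eqP Yw|w [k _] /= kY Yw]; last first.
      by move: kY; rewrite Yw normr0 ltNge invr_ge0 ler0n.
    exists (Num.Def.archi_bound `|Y w|^-1) => //=.
    rewrite invf_plt ?posrE ?normr_gt0// (@lt_le_trans _ _
      (Num.Def.archi_bound `|Y w|^-1)%:R) ?archi_boundP ?invr_ge0//.
    by rewrite ler_nat.
  apply/eqP; rewrite -measure_le0.
  apply: le_trans (measure_sigma_subadditive _ _ _ (@subset_refl _ _)) _.
  - by move=> k; exact: measurable_tail.
  - by apply: bigcupT_measurable => k; exact: measurable_tail.
  rewrite eseries0// => k _ _; apply/eqP; rewrite -[X in X == _]fineK; last first.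
    by rewrite fin_num_measure//; exact: measurable_tail.
  rewrite eqe eq_le fine_ge0// andbT leNgt; apply/negP => h.
  by apply: H; exists k.+1%:R^-1.
rewrite probability_setC//.
rewrite -[P (Y @^-1` [set 0])]fineK ?fin_num_measure// -EFinB => -[/eqP].
by rewrite subr_eq0 => /eqP <-.
Qed.

End TailProbability.

Lemma dt_ss_csi_trichotomy (R : realType) (tau : nat) (d : measure_display)
    (T : measurableType d) (P : probability T R) (X : nat -> {RV P >-> R})
    (b : nat -> R) :
  (0 < tau)%N -> positive_valued b -> dt_ss_csi X tau b ->
  nondegenerate (X 1%N) ->
  [\/ scaling_one b, scaling_padic b | scaling_power b].
Proof.
move=> tau0 b0 [ss csi] nd.
pose D m w := X m.+1 w - X m w.
have mX m : measurable_fun setT (X m) by [].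
have mD m : measurable_fun setT (D m) by exact: measurable_funB.
have le_norm (x y : R) : `|x| <= `|y| + `|x - y|.
  by rewrite (le_trans _ (ler_normD _ _))// subrKC.
apply: (@scaling_trichotomy R b (fun m => tail P (X m)) (fun m => tail P (D m)) tau) => //.
- by move=> m n t n0; rewrite (tail_eq_dist (ss m n n0)) tail_scale// b0.
- by move=> m; exact: tail_noninc.
- by move=> *; exact: tail_ge0.
- by move=> m; exact: tail_cvg0.
- by apply: tail_nonzero => //; apply/eqP => h; apply: nd; exists 0.
- by move=> k m t; rewrite /D (tail_eq_dist (csi k m)).
- by move=> m; exact: tail_noninc.
- by move=> *; exact: tail_ge0.
- by move=> m; exact: tail_cvg0.
- by move=> m s t; apply: tail_le_add => // w; exact: ler_normB.
- by move=> m s t; apply: tail_le_add => // w; exact: le_norm.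
- by move=> m s t; apply: tail_le_add => // w; rewrite /D distrC; exact: le_norm.
Qed.

(** * Independent sequences of uniform variables *)

(** For [I = nat] this is the generating family in [eq_dist_process], so the events there are the
    measurable sets of [seqspace R nat]. *)
Definition coordinate_events (R : realType) (I : Type) : set (set (I -> R)) :=
  \bigcup_i preimage_set_system setT (fun x : I -> R => x i) measurable.
Arguments coordinate_events : clear implicits.

Notation seqspace R I := (g_sigma_algebraType (coordinate_events R I)).

Section SequenceSpace.
Context {R : realType}.

Lemma measurable_coordinate (I : Type) (i : I) :
  measurable_fun setT (fun x : seqspace R I => x i).
Proof.
move=> _ A mA; rewrite setTI; apply: sub_sigma_algebra.
by exists i => //; exists A; rewrite ?setTI.
Qed.

Lemma measurable_seqspace (I : Type) d (T : measurableType d) (f : T -> seqspace R I) :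
  (forall i, measurable_fun setT (fun w => f w i)) -> measurable_fun setT f.
Proof.
move=> mf; apply: (@measurability _ _ T (seqspace R I) setT f (coordinate_events R I) erefl).
move=> _ [_ [i _ [A mA <-]] <-]; rewrite setTI.
exact: mf.
Qed.

End SequenceSpace.

(** * Uniqueness of laws and i.i.d. families *)

Section Laws.
Context {R : realType}.

Definition cylinder (T : Type) (I : eqType) (X : I -> T -> R) (s : seq I)
  (A : I -> set R) : set T := [set w | forall i, i \in s -> A i (X i w)].

Lemma measurable_cylinder d (T : measurableType d) (I : eqType) (X : I -> T -> R)
    (s : seq I) (A : I -> set R) : (forall i, measurable_fun setT (X i)) ->
  (forall i, measurable (A i)) -> measurable (cylinder X s A).
Proof.
move=> mX mA; elim: s => [|i s IH].
  by rewrite (_ : cylinder _ _ _ = setT)//; apply/seteqP; split.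
rewrite (_ : cylinder _ _ _ = X i @^-1` A i `&` cylinder X s A).
  by apply: measurableI => //; rewrite -[X in measurable X]setTI; exact: mX.
apply/seteqP; split=> [w h|w [h1 h2] j].
  by split=> [|j js]; apply: h; rewrite inE ?eqxx// js orbT.
by rewrite inE => /predU1P[->//|/h2].
Qed.

(** Finite cylinders form a pi-system generating the product sigma-algebra: two of them intersect in
    a cylinder over the merged index list, without repetitions. *)
Lemma law_unique (I : eqType) d1 (T1 : measurableType d1) (P1 : probability T1 R)
    d2 (T2 : measurableType d2) (P2 : probability T2 R)
    (X : I -> T1 -> R) (Y : I -> T2 -> R) :
  (forall i, measurable_fun setT (X i)) -> (forall i, measurable_fun setT (Y i)) ->
  (forall s A, uniq s -> (forall i, measurable (A i)) ->
    P1 (cylinder X s A) = P2 (cylinder Y s A)) ->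
  forall B : set (seqspace R I), measurable B ->
    P1 [set w | B (X ^~ w)] = P2 [set w | B (Y ^~ w)].
Proof.
move=> mX mY H.
pose fX : T1 -> seqspace R I := fun w => X ^~ w.
pose fY : T2 -> seqspace R I := fun w => Y ^~ w.
have mfX : measurable_fun setT fX by exact: measurable_seqspace.
have mfY : measurable_fun setT fY by exact: measurable_seqspace.
pose RX : {mfun T1 >-> seqspace R I} := HB.pack fX (isMeasurableFun.Build _ _ _ _ _ mfX).
pose RY : {mfun T2 >-> seqspace R I} := HB.pack fY (isMeasurableFun.Build _ _ _ _ _ mfY).
pose m1 := distribution P1 RX; pose m2 := distribution P2 RY.
pose proj (i : I) (x : seqspace R I) := x i.
have mproj i : measurable_fun setT (proj i) by exact: measurable_coordinate.
pose G : set (set (seqspace R I)) :=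
  [set C | exists s A, [/\ uniq s, forall i, measurable (A i) & C = cylinder proj s A]].
have Gm : G `<=` measurable.
  by move=> _ [s [A [_ mA ->]]]; exact: measurable_cylinder.
have GI : setI_closed G.
  move=> _ _ [s [A [us mA ->]]] [t [B [ut mB ->]]].
  pose C i := (if i \in s then A i else setT) `&` (if i \in t then B i else setT).
  exists (undup (s ++ t)), C; split; first exact: undup_uniq.
    by move=> i; apply: measurableI; case: ifP.
  apply/seteqP; split=> [x [h1 h2] i _|x h].
    by split; case: ifPn => // ?; [exact: h1|exact: h2].
  split=> i hi; have := h i; rewrite mem_undup mem_cat hi ?orbT => /(_ isT)[].
    by rewrite hi.
  by rewrite hi.
have GT : G setT.
  by exists [::], (fun=> setT); split => //; apply/seteqP; split.
have GB : (@measurable _ (seqspace R I)) `<=` <<s G >>.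
  apply: smallest_sub; first exact: smallest_sigma_algebra.
  move=> _ [i _ [A mA <-]]; apply: sub_sigma_algebra.
  exists [:: i], (fun=> A); split => //; rewrite setTI.
  apply/seteqP; split=> x /=.
    by move=> h j; rewrite inE => /eqP ->.
  by move=> h; apply: h; rewrite inE.
move=> B mB.
apply: (@g_sigma_algebra_measure_unique _ R _ G Gm (fun=> setT) _ _ m1 m2 GI) => //.
- by rewrite bigcup_const//; exists 0%N.
- by move=> _ [s [A [us mA ->]]]; exact: H.
- by move=> _; rewrite -ge0_fin_numE// fin_num_measure.
- exact: GB.
Qed.

(** One formula for both requirements: one-element lists give the common law [nu], longer ones
    independence. *)
Definition iid (I : eqType) d (T : measurableType d) (P : probability T R)
    (nu : set R -> \bar R) (X : I -> T -> R) : Prop :=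
  forall s A, uniq s -> (forall i, measurable (A i)) ->
    P (cylinder X s A) = (\prod_(i <- s) nu (A i))%E.

Lemma iid_relabel (I J : eqType) d (T : measurableType d) (P : probability T R)
    (nu : set R -> \bar R) (X : I -> T -> R) (f : J -> I) :
  injective f -> iid P nu X -> iid P nu (fun j => X (f j)).
Proof.
(* [A'] transports [A] along [f]: by injectivity the intersection has a single member on the range
   of [f], and it is [setT] elsewhere. *)
move=> fI iidX s A us mA; pose A' i := \bigcap_(j in [set j | f j = i]) A j.
have A'E j : A' (f j) = A j.
  by apply/seteqP; split=> [x|x h k /= /fI ->//]; apply.
have mA' i : measurable (A' i).
  have [[j <-]|H] := pselect (exists j, f j = i); first by rewrite A'E.
  rewrite /A' (_ : [set j | _] = set0) ?bigcap_set0//.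
  by apply/seteqP; split=> // j fj; apply: H; exists j.
have := iidX (map f s) A'; rewrite map_inj_uniq// us => /(_ isT mA').
rewrite big_map => h; rewrite -(eq_bigr _ (fun j _ => congr1 nu (A'E j))) -h.
congr (P _); apply/seteqP; split=> w h' => [_ /mapP[j js ->]|j js].
  by rewrite A'E; exact: h'.
by rewrite -A'E; apply: h'; rewrite map_f.
Qed.

(** A finite list of indices lies in an initial segment, whose remaining indices receive [setT], of
    mass 1. *)
Lemma iid_initial d (T : measurableType d) (P : probability T R)
    (nu : set R -> \bar R) (X : nat -> T -> R) : nu setT = 1%E ->
  (forall n A, (forall i, measurable (A i)) ->
    P [set w | forall i, (i < n)%N -> A i (X i w)] = (\prod_(i < n) nu (A i))%E) ->
  iid P nu X.
Proof.
move=> nuT H s A us mA; pose n := (\max_(i <- s) i)%N.+1.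
have sn i : i \in s -> (i < n)%N.
  by move=> si; rewrite ltnS; exact: (@leq_bigmax_seq _ s xpredT id i).
pose A' i := if i \in s then A i else setT.
have -> : cylinder X s A = [set w | forall i, (i < n)%N -> A' i (X i w)].
  apply/seteqP; split=> w h i hi; first by rewrite /A'; case: ifPn => // /h.
  by have := h i (sn i hi); rewrite /A' hi.
rewrite H; last by move=> i; rewrite /A'; case: ifP.
rewrite -(big_mkord xpredT (fun i => nu (A' i))).
rewrite (bigID (mem s))/= [X in (_ * X)%E]big1 ?mule1; last first.
  by move=> i /negbTE si; rewrite /A' si.
rewrite -big_filter (perm_big s); last first.
  apply: uniq_perm => //; first by rewrite filter_uniq// iota_uniq.
  move=> i; rewrite mem_filter mem_index_iota/=.
  by case: (boolP (i \in s)) => // /sn ->.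
by rewrite big_seq [RHS]big_seq; apply: eq_bigr => i si; rewrite /A' si.
Qed.

Lemma iid_law_unique (I : eqType) d1 (T1 : measurableType d1) (P1 : probability T1 R)
    d2 (T2 : measurableType d2) (P2 : probability T2 R) (nu : set R -> \bar R)
    (X : I -> T1 -> R) (Y : I -> T2 -> R) :
  (forall i, measurable_fun setT (X i)) -> (forall i, measurable_fun setT (Y i)) ->
  iid P1 nu X -> iid P2 nu Y ->
  forall B : set (seqspace R I), measurable B ->
    P1 [set w | B (X ^~ w)] = P2 [set w | B (Y ^~ w)].
Proof.
by move=> mX mY iX iY; apply: law_unique => // s A us mA; rewrite iX ?iY.
Qed.

End Laws.

(** * Fractional parts and binary digits of a real number *)

Section FractionalPart.
Context {R : realType}.
Implicit Types x y t : R.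

Definition frac x : R := x - (Num.floor x)%:~R.

Lemma frac_ge0 x : 0 <= frac x.
Proof. by rewrite subr_ge0 floor_le. Qed.

Lemma frac_lt1 x : frac x < 1.
Proof. by rewrite ltrBlDl -intrD1 floorD1_gt. Qed.

Lemma floorD_int x (n : int) : Num.floor (x + n%:~R) = Num.floor x + n.
Proof. by rewrite floorDrz ?intrKfloor ?intr_int. Qed.

Lemma fracD_int x (n : int) : frac (x + n%:~R) = frac x.
Proof. by rewrite /frac floorD_int intrD opprD addrACA subrr addr0. Qed.

Lemma frac_id x : 0 <= x < 1 -> frac x = x.
Proof.
by move=> x01; rewrite /frac (@floor_def _ x 0) ?subr0.
Qed.

Lemma frac_eq x : x = frac x + (Num.floor x)%:~R.
Proof. by rewrite subrK. Qed.

Lemma fracD_frac x t : frac (frac x + t) = frac (x + t).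
Proof. by rewrite [in RHS](frac_eq x) [in RHS]addrAC fracD_int. Qed.

Lemma measurable_floor : measurable_fun setT (fun x => (Num.floor x)%:~R : R).
Proof.
apply: nondecreasing_measurable => //= x y xy.
by rewrite ler_int le_floor.
Qed.

Lemma measurable_frac : measurable_fun setT frac.
Proof. by apply: measurable_funB => //; exact: measurable_floor. Qed.

(* The indicator of the upper half [1/2, 1) of the circle; it is also the first
   binary digit. *)
Definition half_bit x : R := (Num.floor (x + 2^-1))%:~R - (Num.floor x)%:~R.

Lemma measurable_half_bit : measurable_fun setT half_bit.
Proof.
apply: measurable_funB; last exact: measurable_floor.
apply: (measurableT_comp measurable_floor).
exact: measurable_funD.
Qed.

Lemma half_bitD_int x (n : int) : half_bit (x + n%:~R) = half_bit x.
Proof. by rewrite /half_bit addrAC !floorD_int !intrD opprD addrACA subrr addr0. Qed.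

Lemma half_bit_fracD x t : half_bit (frac x + t) = half_bit (x + t).
Proof. by rewrite [in RHS](frac_eq x) [in RHS]addrAC half_bitD_int. Qed.

Lemma half_bit_frac x : half_bit (frac x) = half_bit x.
Proof. by rewrite -[frac x]addr0 half_bit_fracD addr0. Qed.

Lemma half_bitD_half x : half_bit (x + 2^-1) = 1 - half_bit x.
Proof.
rewrite /half_bit -addrA (_ : 2^-1 + 2^-1 = 1%:~R :> R); last first.
  by rewrite [RHS](splitr 1) mul1r.
by rewrite floorD_int intrD; ring.
Qed.

Lemma floor_eq0 x : 0 <= x < 1 -> Num.floor x = 0.
Proof. by move=> h; apply: floor_def; rewrite add0r mulr0z mulr1z. Qed.

Lemma floor_eq1 x : 1 <= x < 2 -> Num.floor x = 1.
Proof. by move=> h; apply: floor_def; rewrite intrD !mulr1z. Qed.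

Lemma half_bit_lo x : 0 <= x < 2^-1 -> half_bit x = 0.
Proof.
move=> /andP[x0 x1]; rewrite /half_bit [X in X%:~R - _]floor_eq0; last by lra.
by rewrite [X in _ - X%:~R]floor_eq0 ?subrr//; lra.
Qed.

Lemma half_bit_hi x : 2^-1 <= x < 1 -> half_bit x = 1.
Proof.
move=> /andP[x0 x1]; rewrite /half_bit [X in X%:~R - _]floor_eq1; last by lra.
by rewrite [X in _ - X%:~R]floor_eq0 ?subr0//; lra.
Qed.

Lemma half_bitP x : half_bit x = 0 \/ half_bit x = 1.
Proof.
rewrite -half_bit_frac; have := frac_ge0 x; have := frac_lt1 x.
have [h _ h0|h h1 _] := ltP (frac x) 2^-1.
  by left; apply: half_bit_lo; rewrite h0.
by right; apply: half_bit_hi; rewrite h.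
Qed.

Lemma half_bit_ge0 x : 0 <= half_bit x.
Proof. by case: (half_bitP x) => ->. Qed.

Lemma half_bit_le1 x : half_bit x <= 1.
Proof. by case: (half_bitP x) => ->. Qed.

Lemma floor_double x : (Num.floor (2 * x))%:~R = 2 * (Num.floor x)%:~R + half_bit x.
Proof.
rewrite -half_bit_frac {1}(frac_eq x) mulrDr.
rewrite (_ : 2 * _%:~R = (2 * Num.floor x)%:~R); last first.
  by rewrite intrM.
rewrite floorD_int intrD addrC intrM; congr (_ + _).
have := frac_ge0 x; have := frac_lt1 x.
have [h _ h0|h h1 _] := ltP (frac x) 2^-1.
  rewrite half_bit_lo ?h0// [X in X%:~R]floor_eq0//; lra.
rewrite half_bit_hi ?h// [X in X%:~R]floor_eq1//; lra.
Qed.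

Lemma binary_expansion x n :
  \sum_(i < n) half_bit (2 ^+ i * x) * (2^-1) ^+ i.+1
  = (Num.floor (2 ^+ n * x))%:~R * (2^-1) ^+ n - (Num.floor x)%:~R.
Proof.
elim: n => [|n IH]; first by rewrite big_ord0 mul1r mulr1 subrr.
rewrite big_ord_recr/= IH [2 ^+ n.+1]exprS -[2 * _ * x]mulrA floor_double.
rewrite [2^-1 ^+ n.+1]exprS.
by field.
Qed.

End FractionalPart.

(** * The uniform law on the circle: rotation and doubling *)

Section Uniform.
Context {R : realType}.
Local Notation leb := (@lebesgue_measure R).

Definition unif : probability (measurableTypeR R) R := uniform_prob (@ltr01 R).

(** [a] times the image of Lebesgue measure under [x |-> a x + c] gives half-open intervals their
    length, so it is Lebesgue measure. *)
Lemma lebesgue_measure_affine (a c : R) (A : set R) : 0 < a -> measurable A ->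
  leb A = (a%:E * leb [set x : R | A (a * x + c)%R])%E.
Proof.
move=> a0 mA; pose f : measurableTypeR R -> measurableTypeR R := fun x => a * x + c.
have mf : measurable_fun setT f.
  by apply: measurable_funD => //; exact: measurable_funM.
suff H (m : {measure set (measurableTypeR R) -> \bar R}) :
    (forall B, m B = leb (f @^-1` B)) -> leb A = (a%:E * leb (f @^-1` A))%E.
  exact: (H (pushforward leb f)).
move=> mE; rewrite -mE -[RHS]/(mscale (NngNum (ltW a0)) m A).
apply: lebesgue_measure_unique => // _ [[x y] /= _ <-].
rewrite /mscale/= mE.
have -> : f @^-1` `]x, y]%classic = `](x - c) / a, (y - c) / a]%classic.
  apply/seteqP; split=> z /=; rewrite !in_itv/= /f;
  by rewrite ltr_pdivrMr// ler_pdivlMr// ltrBlDr lerBrDr ![_ * a]mulrC.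
rewrite !lebesgue_measure_itv/= !lte_fin ltr_pM2r ?invr_gt0// ltrD2r.
case: ifPn => _; last by rewrite mule0.
by rewrite -!EFinB -EFinM; congr EFin; field; rewrite gt_eqF.
Qed.

(** The density lives on the closed interval; its null endpoint is removed to match the range of
    [frac]. *)
Lemma unifE (A : set R) : measurable A -> unif A = leb (A `&` `[0, 1[%classic).
Proof.
move=> mA; rewrite /unif/= /uniform_prob integral_uniform_pdf.
rewrite (eq_integral (fun=> 1%E)); last first.
  move=> x; rewrite inE => -[_ /=]; rewrite in_itv/= /uniform_pdf => ->.
  by rewrite subr0 invr1.
rewrite integral_cst ?mul1e//; last exact: measurableI.
have -> : A `&` `[0, 1]%classic = (A `&` `[0, 1[%classic) `|` (A `&` [set 1]).
  apply/seteqP; split=> x /=; rewrite !in_itv/=.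
    move=> [Ax /andP[-> x1]]; move: x1.
    by rewrite le_eqVlt => /predU1P[x1|->]; [right|left].
  case=> -[Ax x01]; split=> //; last by rewrite x01 lexx ler01.
  by move: x01 => /andP[-> /ltW->].
apply: measureU0; [exact: measurableI|exact: measurableI|].
apply/eqP; rewrite -measure_le0 -(@lebesgue_measure_set1 R 1).
by apply: le_measure; rewrite ?inE//; exact: measurableI.
Qed.

(** With [u = frac t], the rotation cuts [[0, 1)] at [1 - u] and translates the two pieces by [u]
    and [u - 1] onto [[u, 1)] and [[0, u)]. *)
Lemma unif_translate_frac (t : R) (A : set R) : measurable A ->
  unif [set x | A (frac (x + t))] = unif A.
Proof.
move=> mA; pose u := frac t.
have u0 : 0 <= u by exact: frac_ge0.
have u1 : u < 1 by exact: frac_lt1.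
have mpre (a b c : R) : measurable [set x | A (x + c) /\ a <= x < b].
  rewrite (_ : [set x | _] = (fun x => x + c) @^-1` A `&` `[a, b[%classic).
    apply: measurableI => //; rewrite -[X in measurable X]setTI.
    exact: (@measurable_funD _ _ R).
  by apply/seteqP; split=> x /=; rewrite in_itv.
have E x : 0 <= x < 1 -> frac (x + t) = if x < 1 - u then x + u else x + (u - 1).
  move=> /andP[x0 x1]; rewrite addrC -fracD_frac -/u.
  case: ltP => h; first by rewrite addrC frac_id//; lra.
  rewrite -(fracD_int _ (-1)) intrN addrC frac_id; lra.
have mfr : measurable [set x | A (frac (x + t))].
  rewrite -[X in measurable X]setTI.
  apply: (measurableT_comp measurable_frac _ :
    measurable_fun setT (fun x : R => frac (x + t))) => //.
  exact: measurable_funD.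
rewrite !unifE//.
have -> : [set x | A (frac (x + t))] `&` `[0, 1[%classic =
    [set x | A (x + u) /\ 0 <= x < 1 - u] `|` [set x | A (x + (u - 1)) /\ 1 - u <= x < 1].
  apply/seteqP; split=> x /=.
    rewrite in_itv/= => -[+ x01]; rewrite E//; case: ltP => h Ax; [left|right];
    by split=> //; lra.
  rewrite in_itv/=; case=> -[Ax xu]; have x01 : 0 <= x < 1 by lra.
    by split=> //; rewrite E// ifT//; lra.
  by split=> //; rewrite E// ifF//; apply/negbTE; rewrite -leNgt; lra.
rewrite measureU/=; [|exact: mpre|exact: mpre|]; last first.
  by apply/seteqP; split=> // x /= [[_ h1] [_ h2]]; lra.
have mAI (a b : R) : measurable [set x | A x /\ a <= x < b].
  rewrite (_ : [set x | _] = A `&` `[a, b[%classic); first exact: measurableI.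
  by apply/seteqP; split=> x /=; rewrite in_itv.
have tr (a b c : R) : leb [set x | A (x + c) /\ a <= x < b] =
    leb [set x | A x /\ a + c <= x < b + c].
  rewrite [RHS](@lebesgue_measure_affine 1 c)// mul1e; congr (leb _).
  by apply/seteqP; split=> x /=; rewrite mul1r lerD2r ltrD2r.
rewrite (tr 0 (1 - u) u) (tr (1 - u) 1 (u - 1)).
rewrite -measureU/=; [|exact: mAI|exact: mAI|]; last first.
  by apply/seteqP; split=> // x /= [[_ h1] [_ h2]]; lra.
congr (leb _); apply/seteqP; split=> x /=; rewrite in_itv/=.
  by case=> -[Ax h]; split=> //; lra.
by move=> [Ax x01]; have [h|h] := ltP x u; [right|left]; split=> //; lra.
Qed.

Lemma unif_frac (A : set R) : measurable A -> unif [set x | A (frac x)] = unif A.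
Proof.
move=> mA; rewrite -[RHS](@unif_translate_frac 0)//; congr (unif _).
by apply/seteqP; split=> x /=; rewrite addr0.
Qed.

Definition fair_bit (A : set R) : \bar R := unif [set x | A (half_bit x)].

Lemma measurable_half_bit_frac_double (A B : set R) : measurable A -> measurable B ->
  measurable [set x : R | A (half_bit x) /\ B (frac (2 * x))].
Proof.
move=> mA mB; apply: (@measurableI _ _ (half_bit @^-1` A)
  ((fun x : R => frac (2 * x)) @^-1` B)).
  by rewrite -[X in measurable X]setTI; exact: measurable_half_bit.
rewrite -[X in measurable X]setTI.
apply: (measurableT_comp measurable_frac _ :
  measurable_fun setT (fun x : R => frac (2 * x))) => //.
Qed.

(** On each half of [[0, 1)] the bit is constant and doubling modulo 1 is an affine bijection onto
    [[0, 1)]. *)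
Let unif_half_bit_double_aux (A B : set R) : measurable A -> measurable B ->
  unif [set x | A (half_bit x) /\ B (frac (2 * x))] =
  ((2^-1)%:E * ((\1_A 0 + \1_A 1)%:E * unif B))%E.
Proof.
move=> mA mB; rewrite !unifE//; last exact: measurable_half_bit_frac_double.
have mpre (v a b c : R) : measurable [set x | A v /\ B (2 * x + c) /\ a <= x < b].
  have [Av|nAv] := pselect (A v); last first.
    by rewrite (_ : [set x | _] = set0)//; apply/seteqP; split=> // x [].
  rewrite (_ : [set x | _] = (fun x => 2 * x + c) @^-1` B `&` `[a, b[%classic).
    apply: measurableI => //; rewrite -[X in measurable X]setTI.
    by apply: (measurable_funD _ _ : measurable_fun setT (fun x : R => 2 * x + c)) => //;
      exact: measurable_funM.
  by apply/seteqP; split=> x /=; rewrite in_itv => //= -[_ []].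
have -> : [set x | A (half_bit x) /\ B (frac (2 * x))] `&` `[0, 1[%classic =
    [set x | A 0 /\ B (2 * x + 0) /\ 0 <= x < 2^-1] `|`
    [set x | A 1 /\ B (2 * x + (- 1)) /\ 2^-1 <= x < 1].
  have lo x : 0 <= x < 2^-1 -> frac (2 * x) = 2 * x + 0.
    by move=> h; rewrite addr0 frac_id//; lra.
  have hi x : 2^-1 <= x < 1 -> frac (2 * x) = 2 * x + (- 1).
    by move=> h; rewrite -(fracD_int _ (-1)) intrN frac_id//; lra.
  apply/seteqP; split=> x /=.
    rewrite in_itv/= => -[[Ax Bx] x01]; have [h|h] := ltP x 2^-1; [left|right].
      have h' : 0 <= x < 2^-1 by lra.
      have Ax0 : A 0 by rewrite -(half_bit_lo h').
      have Bx0 : B (2 * x + 0) by rewrite -lo.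
      split=> //; split=> //; lra.
    have h' : 2^-1 <= x < 1 by lra.
    have Ax1 : A 1 by rewrite -(half_bit_hi h').
    have Bx1 : B (2 * x + (- 1)) by rewrite -hi.
    split=> //; split=> //; lra.
  rewrite in_itv/=; case=> -[Ax [Bx h]]; (split; last by lra).
    by rewrite half_bit_lo// lo.
  by rewrite half_bit_hi// hi.
rewrite measureU/=; [|exact: mpre|exact: mpre|]; last first.
  by apply/seteqP; split=> // x /= [[_ [_ h1]] [_ [_ h2]]]; lra.
set B1 := B `&` `[0, 1[%classic; have mBI : measurable B1 by exact: measurableI.
have half (v a b c : R) : (2 * a + c = 0) -> 2 * b + c = 1 ->
    leb [set x | A v /\ B (2 * x + c) /\ a <= x < b] =
    ((\1_A v)%:E * ((2^-1)%:E * leb B1))%E.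
  move=> h0 h1; rewrite indicE; have [Av|nAv] := boolP (v \in A); last first.
    rewrite mul0e (_ : [set x | _] = set0) ?measure0//.
    by apply/seteqP; split=> // x [Av]; rewrite notin_setE in nAv.
  rewrite mul1e (@lebesgue_measure_affine 2 c _ _ mBI)// muleA -EFinM mulVf// mul1e.
  congr (leb _); apply/seteqP; split=> x; rewrite /B1/= in_itv/=.
    by move=> [_ [Bx h]]; split=> //; lra.
  by move=> [Bx h]; split; [exact/set_mem|split=> //; lra].
rewrite !half//; [|lra..].
have fin : leb B1 \is a fin_num by rewrite -unifE// fin_num_measure.
by rewrite -(fineK fin) -!EFinM -EFinD; congr EFin; ring.
Qed.

(** The first binary digit is independent of the other digits, which again form a uniform point. The
    case [B = setT] identifies the factor depending on [A]. *)
Lemma unif_half_bit_double (A B : set R) : measurable A -> measurable B ->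
  unif [set x | A (half_bit x) /\ B (frac (2 * x))] = (fair_bit A * unif B)%E.
Proof.
move=> mA mB; rewrite unif_half_bit_double_aux// muleA; congr (_ * _)%E.
have := unif_half_bit_double_aux mA measurableT; rewrite probability_setT mule1 => <-.
by rewrite /fair_bit; congr (unif _); apply/seteqP; split=> x //= -[].
Qed.

End Uniform.

(** * Measurable limits *)

Section RealLimit.
Context {R : realType}.

(* A total limit operator which, unlike [lim], sends any sequence of measurable
   functions to a measurable function. *)
Definition rlim (u : nat -> R) : R := fine (limn_esup (EFin \o u)).

Lemma rlimE (u : nat -> R) (l : R) : u @ \oo --> l -> rlim u = l.
Proof.
move=> ul; have ul' : (EFin \o u) @ \oo --> l%:E by apply/fine_cvgP; split => //; exact: nearW.
by rewrite /rlim (cvg_limn_einf_sup ul').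
Qed.

Lemma measurable_rlim d (T : measurableType d) (f : nat -> T -> R) :
  (forall n, measurable_fun setT (f n)) -> measurable_fun setT (fun w => rlim (f ^~ w)).
Proof.
move=> mf; apply: (measurableT_comp (fine_measurable _)) => //.
by apply: measurable_fun_limn_esup => n; exact/measurable_EFinP.
Qed.

End RealLimit.

(** * Splitting one uniform variable into an i.i.d. sequence *)

Section BinaryDigits.
Context {R : realType}.

Definition bit (i : nat) (x : R) : R := half_bit (2 ^+ i * x).

Lemma measurable_bit i : measurable_fun setT (bit i).
Proof. by apply: (measurableT_comp measurable_half_bit); exact: measurable_funM. Qed.

Lemma bit_frac_double i (x : R) : bit i (frac (2 * x)) = bit i.+1 x.
Proof.
rewrite /bit [in RHS]exprSr -mulrA [in RHS](frac_eq (2 * x)) [in RHS]mulrDr.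
have -> : 2 ^+ i * (Num.floor (2 * x))%:~R = (2 ^+ i * Num.floor (2 * x))%:~R :> R.
  by rewrite intrM rmorphXn.
by rewrite half_bitD_int.
Qed.

(** The first digit is split off, and the doubling map shifts the others. *)
Lemma iid_bits : iid unif fair_bit bit.
Proof.
apply: iid_initial; first by rewrite /fair_bit (_ : [set x | _] = setT) ?probability_setT.
elim=> [|n IH] A mA.
  by rewrite big_ord0 (_ : [set x | _] = setT) ?probability_setT//; apply/seteqP; split.
pose B := [set y | forall i, (i < n)%N -> A i.+1 (bit i y)].
have mB : measurable B.
  rewrite (_ : B = cylinder bit (iota 0 n) (fun i => A i.+1)).
    by apply: measurable_cylinder => // i; exact: measurable_bit.
  apply/seteqP; split=> x h i hi; apply: h; move: hi; by rewrite mem_iota.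
rewrite big_ord_recl -(IH (fun i => A i.+1))// -unif_half_bit_double//; congr (unif _).
apply/seteqP; split=> x /=.
  move=> h; split; first by have := h 0%N isT; rewrite /bit mul1r.
  by move=> i hi; rewrite bit_frac_double; exact: h.
move=> [h0 h] [_|i hi]; first by rewrite /bit mul1r.
by rewrite -bit_frac_double; exact: h.
Qed.

Definition binary_value (z : nat -> R) : R :=
  rlim (fun n => \sum_(i < n) z i * (2^-1) ^+ i.+1).

(** The partial sums are [floor (2^n x) / 2^n - floor x], whose first term lies between [x - 2^(-n)]
    and [x]. *)
Lemma binary_value_bits (x : R) : binary_value (bit ^~ x) = frac x.
Proof.
apply: rlimE; under eq_fun do rewrite binary_expansion.
apply: cvgB; last exact: cvg_cst.
have h n : (2 : R) ^+ n != 0 by rewrite expf_neq0.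
apply: (@squeeze_cvgr _ _ _ _ (fun n => x - (2^-1) ^+ n) (fun=> x)).
- apply: nearW => n; rewrite exprVn.
  have /andP[h1 h2] := floor_itv (2 ^+ n * x).
  rewrite ler_pdivrMr ?exprn_gt0// [x * _]mulrC h1 andbT.
  rewrite ler_pdivlMr ?exprn_gt0// mulrBl mulVf// [x * _]mulrC lerBlDr.
  by move: h2; rewrite intrD => /ltW.
- rewrite -[X in _ --> X]subr0; apply: cvgB; first exact: cvg_cst.
  by apply: cvg_expr; rewrite ger0_norm ?invr_ge0// invf_lt1// ltr1n.
- exact: cvg_cst.
Qed.

Lemma measurable_binary_value d (T : measurableType d) (X : nat -> T -> R) :
  (forall i, measurable_fun setT (X i)) ->
  measurable_fun setT (fun w => binary_value (X ^~ w)).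
Proof.
move=> mX; apply: (@measurable_rlim _ _ _
  (fun n w => \sum_(i < n) X i w * (2^-1) ^+ i.+1)) => n.
by apply: measurable_sum => i; exact: measurable_funM.
Qed.

Let R2 : measurableType _ := (measurableTypeR R * measurableTypeR R)%type.

Definition interleaved_bit (n : nat) (w : R2) : R :=
  bit n./2 (if odd n then w.2 else w.1).

Lemma measurable_interleaved_bit n : measurable_fun setT (interleaved_bit n).
Proof.
rewrite /interleaved_bit; case: (odd n);
by apply: (measurableT_comp (measurable_bit _)).
Qed.

Let half_inj b : {in [pred i | odd i == b] &, injective half}.
Proof.
move=> i j /eqP oi /eqP oj ij; rewrite -(odd_double_half i) -(odd_double_half j).
by rewrite oi oj ij.
Qed.

Lemma iid_interleaved_bits :
  iid (unif \x unif : probability R2 R)%E fair_bit interleaved_bit.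
Proof.
move=> s A us mA.
pose s0 b := [seq i./2 | i <- s & odd i == b].
have us0 b : uniq (s0 b).
  rewrite map_inj_in_uniq ?filter_uniq// => i j.
  by rewrite !mem_filter => /andP[oi _] /andP[oj _]; exact: (half_inj oi oj).
pose A0 (b : bool) j := A (b + j.*2)%N.
have A0E b i : odd i = b -> A0 b i./2 = A i.
  by move=> oi; rewrite /A0 -oi odd_double_half.
have -> : cylinder interleaved_bit s A =
    cylinder bit (s0 false) (A0 false) `*` cylinder bit (s0 true) (A0 true).
  apply/seteqP; split=> [[x y] h|[x y] [h1 h2] i si].
    split=> /= j /mapP[i]; rewrite mem_filter => /andP[/eqP oi si ->];
    by have := h i si; rewrite /interleaved_bit A0E// oi.
  rewrite /interleaved_bit.
  have hi b : odd i = b -> i./2 \in s0 b.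
    by move=> oi; apply/mapP; exists i => //; rewrite mem_filter oi eqxx.
  case: (boolP (odd i)) => [oi|/negbTE oi].
    by rewrite -(A0E _ _ oi); exact: (h2 _ (hi _ oi)).
  by rewrite -(A0E _ _ oi); exact: (h1 _ (hi _ oi)).
transitivity (unif (cylinder bit (s0 false) (A0 false)) *
              unif (cylinder bit (s0 true) (A0 true)))%E.
  by apply: product_measure1E; apply: measurable_cylinder => i;
    [exact: measurable_bit|exact: mA|exact: measurable_bit|exact: mA].
have mA0 c i : measurable (A0 c i) by exact: mA.
rewrite (iid_bits (us0 false) (mA0 false)) (iid_bits (us0 true) (mA0 true)).
rewrite !big_map !big_filter [RHS](bigID (fun i => odd i == false))/=.
congr (_ * _)%E.
  by apply: eq_bigr => i /eqP oi; rewrite A0E.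
apply: eq_big => [i|i /eqP oi]; first by case: (odd i).
by rewrite A0E.
Qed.

Definition even_digits (x : R) : R := binary_value (fun i => bit i.*2 x).
Definition odd_digits (x : R) : R := binary_value (fun i => bit i.*2.+1 x).

Lemma measurable_even_digits : measurable_fun setT even_digits.
Proof. by apply: measurable_binary_value => i; exact: measurable_bit. Qed.

Lemma measurable_odd_digits : measurable_fun setT odd_digits.
Proof. by apply: measurable_binary_value => i; exact: measurable_bit. Qed.

(** The bits of one uniform point and the interleaved bits of an independent pair are both i.i.d.
    fair, so they have the same law. Reading the even and the odd positions of the latter recovers
    the pair modulo 1. *)
Lemma unif_digits (A B : set R) : measurable A -> measurable B ->
  unif [set x | A (even_digits x) /\ B (odd_digits x)] = (unif A * unif B)%E.
Proof.
move=> mA mB.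
pose C : set (seqspace R nat) :=
  [set z | A (binary_value (fun i => z i.*2)) /\ B (binary_value (fun i => z i.*2.+1))].
have mC : measurable C.
  have mv (f : nat -> nat) : measurable_fun setT
      (fun z : seqspace R nat => binary_value (fun i => z (f i))).
    by apply: measurable_binary_value => i; exact: measurable_coordinate.
  apply: (@measurableI _ _ ((fun z : seqspace R nat => binary_value (fun i => z i.*2)) @^-1` A)
    ((fun z : seqspace R nat => binary_value (fun i => z i.*2.+1)) @^-1` B));
  by rewrite -[X in measurable X]setTI; exact: mv.
have /= := @iid_law_unique R nat _ _ unif _ _ (unif \x unif : probability R2 R)%E fair_bit _ _
  measurable_bit measurable_interleaved_bit iid_bits iid_interleaved_bits _ mC.
move=> ->; rewrite -(unif_frac mA) -(unif_frac mB) -product_measure1E//.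
- have E1 (w : R2) : (fun i => interleaved_bit i.*2 w) = bit ^~ w.1.
    by apply/funext => i; rewrite /interleaved_bit odd_double doubleK.
  have E2 (w : R2) : (fun i => interleaved_bit i.*2.+1 w) = bit ^~ w.2.
    by apply/funext => i; rewrite /interleaved_bit /= odd_double uphalf_double.
  congr (_ _); apply/seteqP; split=> w;
  by rewrite /C/= E1 E2 !binary_value_bits.
- by rewrite -[X in measurable X]setTI; exact: measurable_frac.
- by rewrite -[X in measurable X]setTI; exact: measurable_frac.
Qed.

(** The even digits give one uniform variable; the odd digits form an independent reservoir for all
    later ones. *)
Fixpoint digit_stream (k : nat) (x : R) : R :=
  if k is k'.+1 then digit_stream k' (odd_digits x) else even_digits x.

Lemma measurable_digit_stream k : measurable_fun setT (digit_stream k).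
Proof.
elim: k => [|k IH]; first exact: measurable_even_digits.
exact: (measurableT_comp IH measurable_odd_digits).
Qed.

Lemma iid_digit_stream : iid unif unif digit_stream.
Proof.
apply: iid_initial; first by rewrite probability_setT.
elim=> [|n IH] A mA.
  by rewrite big_ord0 (_ : [set x | _] = setT) ?probability_setT//; apply/seteqP; split.
pose B := [set y | forall i, (i < n)%N -> A i.+1 (digit_stream i y)].
have mB : measurable B.
  rewrite (_ : B = cylinder digit_stream (iota 0 n) (fun i => A i.+1)).
    by apply: measurable_cylinder => // i; exact: measurable_digit_stream.
  apply/seteqP; split=> x h i hi; apply: h; move: hi; by rewrite mem_iota.
rewrite big_ord_recl -(IH (fun i => A i.+1))// -unif_digits//; congr (unif _).
apply/seteqP; split=> x /=.
  by move=> h; split; [exact: (h 0%N)|move=> i hi; exact: (h i.+1)].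
by move=> [h0 h] [_|i hi]; [exact: h0|exact: h].
Qed.

End BinaryDigits.

(** * Measure-preserving maps and equality of laws *)

Section MeasurePreserving.
Context {R : realType} {d : measure_display} {T : measurableType d}.
Variable P : probability T R.

Definition preserving (S : T -> T) : Prop :=
  measurable_fun setT S /\ forall B, measurable B -> P (S @^-1` B) = P B.

Lemma ae_eq_measure (B C : set T) : measurable B -> measurable C ->
  {ae P, forall w, B w <-> C w} -> P B = P C.
Proof.
move=> mB mC [N [mN N0 BCN]].
rewrite -(measureU0 mB mN N0) -(measureU0 mC mN N0); congr (P _).
apply/seteqP; split=> w /=; case=> h; [|by right| |by right];
by have [[h1 h2]|hN] := pselect (B w <-> C w); [left; auto|right; exact: BCN].
Qed.

Lemma preserving_ae (S : T -> T) (Q : T -> Prop) : preserving S ->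
  {ae P, forall w, Q w} -> {ae P, forall w, Q (S w)}.
Proof.
move=> [mS PS] [N [mN N0 QN]]; exists (S @^-1` N); split.
- by rewrite -[X in measurable X]setTI; exact: mS.
- by rewrite PS.
- by move=> w /= h; exact: QN.
Qed.

(** This reduces the equalities of laws for the p-adic and power processes to almost sure identities
    along a measure-preserving map. *)
Lemma preserving_eq_dist_process (S : T -> T) (X Y : nat -> T -> R) :
  (forall m, measurable_fun setT (X m)) -> (forall m, measurable_fun setT (Y m)) ->
  preserving S -> {ae P, forall w, forall m, Y m w = X m (S w)} ->
  eq_dist_process P X Y.
Proof.
move=> mX mY [mS PS] YX A mA; have {}mA : measurable (A : set (seqspace R nat)) by [].
have mXA : measurable [set w | A (X ^~ w)].
  have := measurable_seqspace mX.
  by move=> /(_ measurableT _ mA); rewrite setTI.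
have mYA : measurable [set w | A (Y ^~ w)].
  have := measurable_seqspace mY.
  by move=> /(_ measurableT _ mA); rewrite setTI.
rewrite -PS//; apply: ae_eq_measure => //.
  by rewrite -[X in measurable X]setTI; exact: mS.
apply: filterS YX => w YX /=.
by rewrite (_ : Y ^~ w = X ^~ (S w))//; apply/funext => m; exact: YX.
Qed.

Lemma eq_dist_process_sym (X Y : nat -> T -> R) :
  eq_dist_process P X Y -> eq_dist_process P Y X.
Proof. by move=> H A mA; rewrite H. Qed.

(** If [X] vanished almost surely, so would its composition with [S], and the two could not differ
    on the non-null event [N]. *)
Lemma preserving_nontrivial (S : T -> T) (X : nat -> {RV P >-> R}) (m : nat) (N : set T) :
  preserving S -> measurable N -> P N != 0%E ->
  {ae P, forall w, N w -> X m (S w) <> X m w} -> nontrivial X.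
Proof.
move=> pS mN /eqP PN H X0; apply: PN.
have X0S := preserving_ae pS X0.
have [M [mM M0 NM]] : {ae P, forall w, ~ N w}.
  apply: filterS3 X0 X0S H => w h1 h2 h3 Nw; apply: (h3 Nw).
  by rewrite h1 h2.
apply/eqP; rewrite -measure_le0 -M0; apply: le_measure; rewrite ?inE// => w Nw.
by apply: NM => /=; apply.
Qed.

End MeasurePreserving.

(** * Independent uniform phases and their symmetries *)

Section CircleSequences.
Context {R : realType}.

Section Canonical.
Variable I : countType.

Definition circle_seq (x : measurableTypeR R) : seqspace R I :=
  fun i => digit_stream (pickle i) x.

Lemma measurable_circle_seq : measurable_fun setT circle_seq.
Proof. by apply: measurable_seqspace => i; exact: measurable_digit_stream. Qed.

HB.instance Definition _ :=
  isMeasurableFun.Build _ _ _ _ circle_seq measurable_circle_seq.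

(** The product of uniform laws over a countable index type, realised as the law of a digit stream
    indexed through [pickle]. *)
Definition circle_prob : probability (seqspace R I) R :=
  distribution unif circle_seq.

Lemma iid_circle_prob :
  iid circle_prob unif (fun (i : I) (z : seqspace R I) => z i).
Proof.
move=> s A us mA.
have pI : injective (@pickle I) := pcan_inj pickleK.
exact: (iid_relabel pI iid_digit_stream).
Qed.

Definition relabel_rotate (f : I -> I) (t : I -> R) (z : seqspace R I) : seqspace R I :=
  fun i => frac (z (f i) + t i).

Lemma measurable_rotate (t : R) : measurable_fun setT (fun x : R => frac (x + t)).
Proof. by apply: (measurableT_comp measurable_frac); exact: measurable_funD. Qed.

(** An injective relabelling keeps the family i.i.d., and a rotation keeps each member uniform. *)
Lemma relabel_rotate_preserving (f : I -> I) (t : I -> R) : injective f ->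
  preserving circle_prob (relabel_rotate f t).
Proof.
move=> fI; have mc i : measurable_fun setT (fun z : seqspace R I => z i).
  exact: measurable_coordinate.
have mrr i : measurable_fun setT (fun z : seqspace R I => relabel_rotate f t z i).
  exact: (measurableT_comp (measurable_rotate (t i)) (mc (f i))).
split; first exact: measurable_seqspace.
move=> B mB; apply: (iid_law_unique mrr mc _ iid_circle_prob mB) => s A us mA.
have := iid_relabel fI iid_circle_prob.
move=> /(_ s (fun i => [set x | A i (frac (x + t i))]) us) H.
transitivity (\prod_(i <- s) unif [set x | A i (frac (x + t i))])%E.
  apply: H => i; rewrite -[X in measurable X]setTI; exact: measurable_rotate.
by apply: eq_bigr => i _; rewrite unif_translate_frac.
Qed.

End Canonical.

Lemma unif_preserving_rotate (t : R) : preserving unif (fun u => frac (u + t)).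
Proof.
by split=> [|B mB]; [exact: measurable_rotate|exact: unif_translate_frac].
Qed.

(** Fubini: at fixed [u] the section has the same mass as its preimage under [S u], and the
    remaining integral is invariant under [rho]. *)
Lemma skew_product_preserving d (T : measurableType d) (P : probability T R)
    (rho : measurableTypeR R -> measurableTypeR R) (S : R -> T -> T) :
  preserving unif rho -> (forall u, preserving P (S u)) ->
  measurable_fun setT (fun w : measurableTypeR R * T => S w.1 w.2) ->
  preserving (unif \x P)%E (fun w => (rho w.1, S w.1 w.2)).
Proof.
move=> [mrho Prho] PS mS.
have mskew : measurable_fun setT (fun w : measurableTypeR R * T => (rho w.1, S w.1 w.2)).
  by apply: measurable_fun_pair => //; exact: measurableT_comp mrho _.
split=> // B mB; rewrite /= /product_measure1.
have mh : measurable_fun setT (P \o xsection B) by exact: measurable_fun_xsection.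
transitivity (\int[unif]_u ((P \o xsection B) \o rho) u)%E.
  apply: eq_integral => u _ /=; rewrite -[RHS](PS u).2; last exact: measurable_xsection.
  congr (P _); apply/seteqP; split=> z; rewrite /xsection/=; by rewrite !inE.
rewrite -(ge0_integral_pushforward mrho unif measurableT mh)//.
apply: eq_measure_integral => A mA _.
exact: Prho.
Qed.

End CircleSequences.

(** * The p-adic process *)

Lemma geometric_weight_cvg (R : realType) (r C : R) (c : nat -> R) : 0 <= r < 1 ->
  (forall k, `|c k| <= C) -> cvgn (series (fun k => r ^+ k * c k)).
Proof.
move=> /andP[r0 r1] cC; apply: normed_cvg.
apply: (@series_le_cvg _ _ (fun k => C * r ^+ k)) => [k|k|k|].
- by rewrite normr_ge0.
- by rewrite mulr_ge0 ?exprn_ge0// (le_trans (normr_ge0 (c k))).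
- by rewrite /= normrM normrX ger0_norm// mulrC ler_wpM2r// exprn_ge0.
- by apply: is_cvg_geometric_series; rewrite ger0_norm.
Qed.

Section PadicProcess.
Context {R : realType}.
Variables (p : nat) (r : R).
Hypotheses (p_prime : prime p) (r01 : 0 < r < 1).

Local Notation Omega := (seqspace R (nat * nat)%type).
Local Notation P := (@circle_prob R (nat * nat)%type).

Definition padic_term (m : nat) (z : Omega) (k : nat) : R :=
  r ^+ k * (half_bit (z (k, m %% p ^ k)%N) - half_bit (z (k, 0%N))).

Definition padic_process (m : nat) (z : Omega) : R := rlim (series (padic_term m z)).

Lemma padic_process_cvg m z : series (padic_term m z) @ \oo --> padic_process m z.
Proof.
have cv : cvgn (series (padic_term m z)).
  have r01' : 0 <= r < 1 by case/andP: r01 => /ltW-> ->.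
  apply: (@geometric_weight_cvg _ _ 1 _ r01') => k.
  have := half_bit_ge0 (z (k, m %% p ^ k)%N); have := half_bit_le1 (z (k, m %% p ^ k)%N).
  have := half_bit_ge0 (z (k, 0%N)); have := half_bit_le1 (z (k, 0%N)).
  by move=> *; rewrite ler_norml; lra.
by rewrite /padic_process (rlimE cv).
Qed.

Lemma measurable_padic_process m : measurable_fun setT (padic_process m).
Proof.
apply: (@measurable_rlim _ _ _ (fun n z => series (padic_term m z) n)) => n.
rewrite /series/=; apply: measurable_sum => k.
apply: measurable_funM => //; apply: measurable_funB;
by apply: (measurableT_comp measurable_half_bit); exact: measurable_coordinate.
Qed.

HB.instance Definition _ m :=
  isMeasurableFun.Build _ _ _ _ (padic_process m) (measurable_padic_process m).

(* The affine map [i |-> n i + j] sends residues mod [p^k] injectively to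
   residues mod [p^(v+k)], where [v] is the valuation of [n]; the indices
   [i >= p^k], which the process never reads, are moved out of the way. *)
Definition affine_index (n j : nat) (a : nat * nat) : nat * nat :=
  let v := logn p n in
  ((v + a.1)%N, if (a.2 < p ^ a.1)%N then ((n * a.2 + j) %% p ^ (v + a.1))%N
                else (p ^ v * a.2)%N).

(** Write [n = n' p^v] with [n'] coprime to [p]: congruence of [n i] and [n i'] mod [p^(v + k)]
    forces that of [i] and [i'] mod [p^k]. The images of the unread indices are at least
    [p^(v + k)], so they meet no residue. *)
Lemma affine_index_inj n j : (0 < n)%N -> injective (affine_index n j).
Proof.
move=> n0; have p0 := prime_gt0 p_prime.
have [n' co nE] := pfactor_coprime p_prime n0.
have pv0 : (0 < p ^ logn p n)%N by rewrite expn_gt0 p0.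
move=> [k i] [k' i']; rewrite /affine_index/= => -[/addnI <-].
case: (ltnP i (p ^ k)) => ik; case: (ltnP i' (p ^ k)) => ik';
  [move=> /eqP|move=> h|move=> h|move=> /eqP].
- rewrite eqn_modDr => /eqP h; suff -> : i = i' by [].
  wlog le : i i' ik ik' h / (i <= i')%N.
    by move=> H; have [le|/ltnW le] := leqP i i'; [exact: H|apply/esym/H].
  move/esym/eqP: h; rewrite eqn_mod_dvd ?leq_mul2l ?le ?orbT// -mulnBr.
  rewrite [in X in (_ %| X)%N]nE mulnAC [(_ * p ^ _)%N]mulnC expnD dvdn_pmul2l//.
  rewrite Gauss_dvdr; last by rewrite coprimeXl.
  by rewrite -eqn_mod_dvd// !modn_small// => /eqP ->.
- exfalso; have : ((n * i + j) %% p ^ (logn p n + k) < p ^ (logn p n + k))%N.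
    by rewrite ltn_mod expn_gt0 p0.
  by rewrite h expnD ltn_pmul2l// ltnNge ik'.
- exfalso; have : ((n * i' + j) %% p ^ (logn p n + k) < p ^ (logn p n + k))%N.
    by rewrite ltn_mod expn_gt0 p0.
  by rewrite -h expnD ltn_pmul2l// ltnNge ik.
- by rewrite eqn_pmul2l// => /eqP ->.
Qed.

(** Since [p^(v + k)] divides [n p^k], with [v] the valuation of [n], only [m] mod [p^k] matters.
    The reference bits at index 0 cancel in the difference. *)
Lemma padic_term_affine n j m z k : (0 < n)%N ->
  padic_term (n * m + j) z (logn p n + k) - padic_term j z (logn p n + k)
  = r ^+ logn p n *
    padic_term m (relabel_rotate (affine_index n j) (fun=> 0) z) k.
Proof.
move=> n0; have p0 := prime_gt0 p_prime.
have pk0 : (0 < p ^ k)%N by rewrite expn_gt0 p0.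
rewrite /padic_term /relabel_rotate !half_bit_frac !addr0 /affine_index/= pk0 ltn_mod pk0.
rewrite muln0 add0n.
have -> : ((n * (m %% p ^ k) + j) %% p ^ (logn p n + k)
           = (n * m + j) %% p ^ (logn p n + k))%N.
  apply/eqP; rewrite eqn_modDr {2}(divn_eq m (p ^ k)) mulnDr.
  have /dvdnP[c ->] : (p ^ (logn p n + k) %| n * (m %/ p ^ k * p ^ k))%N.
    by rewrite mulnCA expnD dvdn_mull// dvdn_mul// pfactor_dvdnn.
  by rewrite modnMDl.
by rewrite exprD; ring.
Qed.

Lemma padic_term_low n j m z k : (k < logn p n)%N ->
  padic_term (n * m + j) z k - padic_term j z k = 0.
Proof.
move=> kv; rewrite /padic_term.
have /dvdnP[c ->] : (p ^ k %| n * m)%N.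
  by rewrite dvdn_mulr// (dvdn_trans _ (pfactor_dvdnn p n))// dvdn_exp2l// ltnW.
by rewrite modnMDl subrr.
Qed.

Lemma padic_process_affine n j m z : (0 < n)%N ->
  padic_process (n * m + j) z - padic_process j z
  = r ^+ logn p n *
    padic_process m (relabel_rotate (affine_index n j) (fun=> 0) z).
Proof.
move=> n0; set z' := relabel_rotate _ _ _; set v := logn p n.
have lhs : series (padic_term (n * m + j) z) N - series (padic_term j z) N @[N --> \oo]
    --> padic_process (n * m + j) z - padic_process j z.
  by apply: cvgB; exact: padic_process_cvg.
have rhs : r ^+ v * series (padic_term m z') N @[N --> \oo]
    --> r ^+ v * padic_process m z'.
  by apply: cvgM; [exact: cvg_cst|exact: padic_process_cvg].
(* The first [v] terms of the difference vanish, and dropping them aligns the two series. *)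
move: lhs; rewrite -(cvg_shiftn v).
have -> : (fun N => series (padic_term (n * m + j) z) (N + v)%N -
                    series (padic_term j z) (N + v)%N)
    = (fun N => r ^+ v * series (padic_term m z') N).
  apply/funext => N; rewrite /series/= !big_mkord -sumrB addnC big_split_ord/=.
  rewrite big1 ?add0r => [|i _]; last exact: padic_term_low.
  by rewrite mulr_sumr; apply: eq_bigr => i _; rewrite padic_term_affine.
by move=> lhs; exact: (cvg_unique _ lhs rhs).
Qed.

Lemma padic_process_nontrivial : nontrivial (P := P) padic_process.
Proof.
(* A half turn of the variable at [(1, 1)] flips its bit, which occurs only in the term [k = 1] of
   [X_1]; so [X_1] changes by [r] or [-r]. *)
pose t (a : nat * nat) : R := if a == (1, 1)%N then 2^-1 else 0.
apply: (@preserving_nontrivial _ _ _ _ (relabel_rotate id t) _ 1%N setT) => //.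
- exact: relabel_rotate_preserving.
- by rewrite probability_setT oner_neq0.
apply: aeW => z _ E; set z' := relabel_rotate id t z in E.
have : series (padic_term 1 z') N - series (padic_term 1 z) N @[N --> \oo]
    --> padic_process 1 z' - padic_process 1 z.
  by apply: cvgB; exact: padic_process_cvg.
rewrite E subrr -(cvg_shiftn 2) => H.
have D n : series (padic_term 1 z') (n + 2)%N - series (padic_term 1 z) (n + 2)%N =
    r * (1 - 2 * half_bit (z (1, 1)%N)).
  rewrite /series/= !big_mkord -sumrB addnC !big_split_ord/= !big_ord_recl big_ord0/=.
  rewrite big1 ?addr0 => [|i _]; last first.
    rewrite /padic_term /z' /relabel_rotate !half_bit_frac /t !xpair_eqE/=.
    by rewrite !addr0 subrr.
  rewrite /padic_term /z' /relabel_rotate !half_bit_frac /t !xpair_eqE/= expn0 modn1/=.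
  rewrite expn1 modn_small ?prime_gt1//= !addr0 half_bitD_half expr0 expr1.
  by ring.
move: H; rewrite (funext D) => H.
have E0 : 0 = r * (1 - 2 * half_bit (z (1, 1)%N)).
  by apply: (cvg_unique _ H) => //; exact: cvg_cst.
have /andP[r0 _] := r01.
by case: (half_bitP (z (1, 1)%N)) E0 => ->; nra.
Qed.

(** Both properties come from [padic_process_affine]: [j = 0] gives self-similarity and [n = 1]
    stationary increments. *)
Lemma padic_process_dt_ss_si (b : nat -> R) :
  (forall n, (0 < n)%N -> b n = r ^+ logn p n) ->
  dt_ss_si (P := P) padic_process b.
Proof.
have mp := measurable_padic_process.
have X0 z : padic_process 0 z = 0.
  apply/rlimE; rewrite (_ : series _ = fun=> 0); first exact: cvg_cst.
  by apply/funext => n; rewrite /series/= big1// => i _; rewrite /padic_term mod0n subrr mulr0.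
move=> bE; split=> [n n0|k k0].
  apply: eq_dist_process_sym.
  apply: (@preserving_eq_dist_process _ _ _ _ (relabel_rotate (affine_index n 0) (fun=> 0))).
  - by move=> m; exact: measurable_funM.
  - by move=> m.
  - by apply: relabel_rotate_preserving; exact: affine_index_inj.
  apply: aeW => z m.
  by rewrite bE// -padic_process_affine// addn0 X0 subr0.
apply: (@preserving_eq_dist_process _ _ _ _ (relabel_rotate (affine_index 1 k) (fun=> 0))).
- by move=> m; exact: measurable_funB.
- by move=> m; exact: measurable_funB.
- by apply: relabel_rotate_preserving; exact: affine_index_inj.
apply: aeW => z m /=.
have h i := @padic_process_affine 1 k i z isT.
move: (h m) (h m.+1); rewrite logn1 !mul1r !mul1n addSn => <- <-.
by rewrite opprB addrA subrK.
Qed.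

End PadicProcess.

(** * The process with scaling a power *)

Lemma cvg_ext (R : realType) (u v : nat -> R) (l : R) :
  u =1 v -> u @ \oo --> l -> v @ \oo --> l.
Proof. by move/funext ->. Qed.

(** * Series over the integers and their shifts *)

Section TwoSidedSeries.
Context {R : realType}.
Implicit Types (a : int -> R) (l : R).

(** Pairing [i] with [-(i + 1)] makes the [n]-th partial sum run over [-n <= k < n]. *)
Definition two_sided_sum a : nat -> R :=
  series (fun i : nat => a i%:Z + a (- i.+1%:Z)).

(** A shift of the index changes partial sums by boundary terms; demanding that these tend to 0
    makes the notion shift invariant. *)
Definition two_sided_cvg a l : Prop :=
  [/\ two_sided_sum a @ \oo --> l, a n%:Z @[n --> \oo] --> 0
    & a (- n%:Z) @[n --> \oo] --> 0].

Lemma two_sided_sum_shift a n :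
  two_sided_sum (fun k => a (k + 1)) n = two_sided_sum a n + a n%:Z - a (- n%:Z).
Proof.
elim: n => [|n IH].
  by rewrite /two_sided_sum /series/= !big_geq// add0r oppr0 subrr.
have S a' : two_sided_sum a' n.+1 = two_sided_sum a' n + (a' n%:Z + a' (- n.+1%:Z)).
  by rewrite /two_sided_sum seriesSr.
rewrite !S IH.
have -> : (n%:Z + 1 = n.+1%:Z)%R by lia.
have -> : (- n.+1%:Z + 1 = - n%:Z)%R by lia.
by ring.
Qed.

Lemma two_sided_cvg_shift1 a l :
  two_sided_cvg a l -> two_sided_cvg (fun k => a (k + 1)) l.
Proof.
move=> [Sl ap an]; split.
- rewrite (funext (two_sided_sum_shift a)).
  rewrite -[l]addr0 -[l + 0]subr0; apply: cvgB => //.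
  exact: cvgD.
- move: ap; rewrite -(cvg_shiftn 1); apply: cvg_ext => n.
  by congr a; lia.
- rewrite -(cvg_shiftn 1); move: an; apply: cvg_ext => n.
  by congr a; lia.
Qed.

Lemma two_sided_cvg_shiftN1 a l :
  two_sided_cvg a l -> two_sided_cvg (fun k => a (k - 1)) l.
Proof.
move=> [Sl ap an]; split.
- have E n : two_sided_sum (fun k => a (k - 1)) n =
      two_sided_sum a n - a (n%:Z - 1) + a (- n%:Z - 1).
    have := two_sided_sum_shift (fun k => a (k - 1)) n.
    rewrite (_ : (fun k => a (k + 1 - 1)) = a); last by apply/funext => k; rewrite addrK.
    by move=> ->; ring.
  rewrite (funext E) -[l]subr0 -[l - 0]addr0; apply: cvgD; first apply: cvgB => //.
    rewrite -(cvg_shiftn 1); move: ap; apply: cvg_ext => n.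
    by congr a; lia.
  move: an; rewrite -(cvg_shiftn 1); apply: cvg_ext => n.
  by congr a; lia.
- rewrite -(cvg_shiftn 1); move: ap; apply: cvg_ext => n.
  by congr a; lia.
- move: an; rewrite -(cvg_shiftn 1); apply: cvg_ext => n.
  by congr a; lia.
Qed.

Lemma two_sided_cvg_shift a l (s : int) :
  two_sided_cvg a l -> two_sided_cvg (fun k => a (k + s)) l.
Proof.
elim/int_rec: s => [|s IH|s IH] h.
- by rewrite (_ : (fun k => _) = a)//; apply/funext => k; rewrite addr0.
- have := two_sided_cvg_shift1 (IH h); congr (two_sided_cvg _ _).
  by apply/funext => k; congr a; lia.
- have := two_sided_cvg_shiftN1 (IH h); congr (two_sided_cvg _ _).
  by apply/funext => k; congr a; lia.
Qed.

Lemma two_sided_cvgZ a l (c : R) :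
  two_sided_cvg a l -> two_sided_cvg (fun k => c * a k) (c * l).
Proof.
move=> [Sl ap an]; split.
- have E n : two_sided_sum (fun k => c * a k) n = c * two_sided_sum a n.
    by rewrite /two_sided_sum /series/= mulr_sumr; apply: eq_bigr => i _; rewrite mulrDr.
  by rewrite (funext E); apply: cvgM => //; exact: cvg_cst.
- by rewrite -[X in _ --> X](mulr0 c); apply: cvgM => //; exact: cvg_cst.
- by rewrite -[X in _ --> X](mulr0 c); apply: cvgM => //; exact: cvg_cst.
Qed.

Lemma two_sided_cvgB a a' l l' : two_sided_cvg a l -> two_sided_cvg a' l' ->
  two_sided_cvg (fun k => a k - a' k) (l - l').
Proof.
move=> [Sl ap an] [Sl' ap' an']; split.
- have E n : two_sided_sum (fun k => a k - a' k) n = two_sided_sum a n - two_sided_sum a' n.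
    rewrite /two_sided_sum /series/= -sumrB; apply: eq_bigr => i _.
    by rewrite opprD addrACA.
  by rewrite (funext E); exact: cvgB.
- by rewrite -[X in _ --> X](subrr (0 : R)); exact: cvgB.
- by rewrite -[X in _ --> X](subrr (0 : R)); exact: cvgB.
Qed.

Lemma two_sided_cvg_single (c : R) : two_sided_cvg (fun k => if k == 1 then c else 0) c.
Proof.
split.
- rewrite -(cvg_shiftn 2); apply: (@cvg_ext _ (fun=> c)); last exact: cvg_cst.
  move=> n; rewrite /two_sided_sum /series/= big_mkord addnC big_split_ord/=.
  by rewrite !big_ord_recl big_ord0 big1 ?addr0 ?add0r.
- rewrite -(cvg_shiftn 2); apply: (@cvg_ext _ (fun=> 0)); last exact: cvg_cst.
  by move=> n /=; rewrite addn2.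
- by apply: (@cvg_ext _ (fun=> 0)); [case|exact: cvg_cst].
Qed.

Lemma two_sided_cvg_geometric a (r C : R) : 0 < r < 1 ->
  (exists K, forall n, (K <= n)%N -> a n%:Z = 0) ->
  (forall n, `|a (- n%:Z)| <= C * r ^+ n) -> exists l, two_sided_cvg a l.
Proof.
move=> /andP[r0 r1] [K aK] aC.
have r1' : `|r| < 1 by rewrite ger0_norm// ltW.
have cneg : cvgn (series (fun i : nat => a (- i.+1%:Z))).
  apply: normed_cvg; apply: (@series_le_cvg _ _ (fun i => C * r * r ^+ i)) => [i|i|i|].
  - exact: normr_ge0.
  - by rewrite -mulrA -exprS (le_trans _ (aC i.+1)).
  - by rewrite /= (le_trans (aC i.+1))// exprS mulrA.
  - exact: is_cvg_geometric_series.
have cpos : series (fun i : nat => a i%:Z) @ \oo --> series (fun i : nat => a i%:Z) K.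
  rewrite -(cvg_shiftn K); set L := series _ K.
  apply: (@cvg_ext _ (fun=> L)); last exact: cvg_cst.
  move=> n; rewrite /L /series/= !big_mkord addnC big_split_ord/= [X in _ + X]big1 ?addr0//.
  by move=> i _; rewrite aK// leq_addr.
have [l hl] : exists l, series (fun i : nat => a (- i.+1%:Z)) @ \oo --> l.
  by exists (limn (series (fun i : nat => a (- i.+1%:Z)))).
exists (series (fun i : nat => a i%:Z) K + l); split.
- have E n : two_sided_sum a n = series (fun i : nat => a i%:Z) n +
      series (fun i : nat => a (- i.+1%:Z)) n.
    by rewrite /two_sided_sum /series/= big_split.
  by rewrite (funext E); exact: cvgD.
- rewrite -(cvg_shiftn K); apply: (@cvg_ext _ (fun=> 0)); last exact: cvg_cst.
  by move=> n /=; rewrite aK// leq_addl.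
- apply/cvgr0Pnorm_le => /= e e0.
  have : C * r ^+ n @[n --> \oo] --> 0.
    by rewrite -[X in _ --> X](mulr0 C); apply: cvgM; [exact: cvg_cst|exact: cvg_expr].
  move/cvgr0Pnorm_le => /(_ e e0); apply: filterS => n; apply: le_trans.
  by rewrite (le_trans (aC n))// ler_norm.
Qed.

End TwoSidedSeries.

Lemma borel_cantelli_geometric (R : realType) d (T : measurableType d)
    (P : probability T R) (F : nat -> set T) (C r : R) : 0 <= r < 1 ->
  (forall i, measurable (F i)) -> (forall i, (P (F i) <= (C * r ^+ i)%:E)%E) ->
  {ae P, forall w, exists K, forall n, (K <= n)%N -> ~ F n w}.
Proof.
move=> /andP[r0 r1] mF PF; exists (lim_sup_set F); split.
- apply: bigcap_measurable => // n _.
  by apply: bigcup_measurable => k _; exact: mF.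
- apply: lim_sup_set_cvg0 => //.
  have C0 : 0 <= C.
    by have := le_trans (measure_ge0 P (F 0%N)) (PF 0%N); rewrite lee_fin expr0 mulr1.
  apply: (@le_lt_trans _ _ (C / (1 - r))%:E); last exact: ltry.
  apply: lime_le; first exact: is_cvg_nneseries.
  apply: nearW => n; apply: (@le_trans _ _ (\sum_(0 <= i < n) (C * r ^+ i)%:E)%E).
    by apply: lee_sum => i _; exact: PF.
  rewrite sumEFin lee_fin big_mkord -mulr_sumr ler_wpM2l//.
  rewrite -[leRHS]div1r ler_pdivlMr ?subr_gt0// mulrC.
  by rewrite -[1 - r]opprB mulNr -subrX1 opprB gerBl exprn_ge0.
- move=> w /= h n _; apply: contrapT => nF; apply: h; exists n => k nk Fk.
  by apply: nF; exists k.
Qed.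

(** The hypothesis keeps [2 (e + x)] below the integer following [2 x], so its floor is unchanged.
    By [floor_double] the two bits then differ by an even integer, hence agree. *)
Lemma half_bit_stable (R : realType) (x e : R) : 0 <= e -> frac (2 * x) < 1 - 2 * e ->
  half_bit (e + x) = half_bit x.
Proof.
move=> e0 xe; have f0 := frac_ge0 (2 * x).
have E2 : Num.floor (2 * (e + x)) = Num.floor (2 * x).
  apply: floor_def; rewrite intrD mulr1z; have := frac_eq (2 * x); lra.
have := floor_double (e + x); rewrite E2 floor_double => h.
have {}h : ((2 * (Num.floor (e + x) - Num.floor x))%:~R : R) = half_bit x - half_bit (e + x).
  by rewrite intrM intrB; lra.
case: (half_bitP x) (half_bitP (e + x)) h => -> [] -> //; rewrite ?subr0 ?sub0r.
  by rewrite -[- 1]/((- 1)%:~R) => /intr_inj; lia.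
by rewrite -[1]/(1%:~R) => /intr_inj; lia.
Qed.

(** * Octaves with random phases: convergence, symmetries, non-triviality *)

Section PowerProcess.
Context {R : realType}.
Variable H : R.
Hypothesis H_gt0 : 0 < H.

Local Notation Omega := (measurableTypeR R * seqspace R int)%type.
Local Notation P := (unif \x @circle_prob R int : probability Omega R)%E.

Definition frequency (k : int) (u : R) : R := expR (- (k%:~R + u)).
Definition amplitude (k : int) (u : R) : R := expR (H * (k%:~R + u)).

Definition power_term (m : nat) (w : Omega) (k : int) : R :=
  amplitude k w.1 *
  (half_bit (m%:R * frequency k w.1 + w.2 k) - half_bit (w.2 k)).

Definition power_process (m : nat) (w : Omega) : R :=
  rlim (two_sided_sum (power_term m w)).

Lemma power_processE m w l : two_sided_cvg (power_term m w) l -> power_process m w = l.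
Proof. by case=> h _ _; exact: rlimE. Qed.

Let measurable_phase (k : int) : measurable_fun setT (fun w : Omega => w.2 k).
Proof. exact: (measurableT_comp (measurable_coordinate k)). Qed.

Let measurable_octave (k : int) : measurable_fun setT (fun w : Omega => k%:~R + w.1 : R).
Proof. by apply: measurable_funD => //; exact: measurable_fst. Qed.

Lemma measurable_frequency (k : int) :
  measurable_fun setT (fun w : Omega => frequency k w.1).
Proof. by apply: (measurableT_comp (@measurable_expR R)); exact: measurable_funN. Qed.

Lemma measurable_power_term m (k : int) :
  measurable_fun setT (fun w => power_term m w k).
Proof.
apply: measurable_funM.
  by apply: (measurableT_comp (@measurable_expR R)); exact: measurable_funM.
apply: measurable_funB; apply: (measurableT_comp measurable_half_bit) => //.
by apply: measurable_funD => //; apply: measurable_funM => //; exact: measurable_frequency.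
Qed.

Lemma measurable_power_process m : measurable_fun setT (power_process m).
Proof.
apply: (@measurable_rlim _ _ _ (fun n w => two_sided_sum (power_term m w) n)) => n.
rewrite /two_sided_sum /series/=; apply: measurable_sum => k.
by apply: measurable_funD; exact: measurable_power_term.
Qed.

HB.instance Definition _ m :=
  isMeasurableFun.Build _ _ _ _ (power_process m) (measurable_power_process m).

Let ae_phase (B : set R) : measurable B -> unif B = 1%E ->
  {ae P, forall w : Omega, B w.1}.
Proof.
move=> mB B1; exists (~` (B `*` setT)); split.
- by apply: measurableC; exact: measurableX.
- have mX : measurable (B `*` setT : set Omega) by exact: measurableX.
  have PB : P (B `*` setT) = 1%E.
    transitivity (unif B * @circle_prob R int setT)%E; first exact: product_measure1E.
    by rewrite B1 probability_setT mul1e.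
  by rewrite probability_setC// PB subee.
- by move=> w /= h [].
Qed.

Lemma ae_octave01 : {ae P, forall w : Omega, 0 <= w.1 < 1}.
Proof.
have E : [set u : R | 0 <= u < 1] = `[0, 1[%classic.
  by apply/seteqP; split=> u /=; rewrite in_itv.
apply: (@ae_phase [set u : R | 0 <= u < 1]); first by rewrite E.
rewrite unifE E// setIid lebesgue_measure_itv/= lte_fin ltr01.
by rewrite oppr0 adde0.
Qed.

Lemma circle_prob_coordinate (k : int) (B : set R) : measurable B ->
  P [set w : Omega | B (w.2 k)] = unif B.
Proof.
move=> mB; pose B' : set (seqspace R int) := [set z | B (z k)].
have mB' : measurable B'.
  by have := measurable_coordinate k measurableT mB; rewrite setTI.
rewrite (_ : [set w | _] = setT `*` B'); last by apply/seteqP; split=> w //= [].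
transitivity (@unif R setT * @circle_prob R int B')%E; first exact: product_measure1E.
rewrite probability_setT mul1e.
have := @iid_circle_prob R int [:: k] (fun=> B) isT (fun=> mB).
rewrite big_seq1 => <-; congr (_ _); apply/seteqP; split=> z /=.
  by move=> h i; rewrite inE => /eqP ->.
by move=> h; apply: h; rewrite inE.
Qed.

Lemma power_term_ae_cvg :
  {ae P, forall w, forall m, exists l, two_sided_cvg (power_term m w) l}.
Proof.
apply: ae_foralln => m.
have e1 : 0 <= expR (- 1 : R) < 1 by rewrite expR_ge0 expR_lt1 oppr_lt0 ltr01.
(* A bound for the displacement [m e^(-(n + u))] of the phase [n], valid for [u >= 0]. *)
pose e (n : nat) : R := m%:R * expR (- 1) ^+ n.
have e_ge0 n : 0 <= e n by rewrite mulr_ge0// exprn_ge0// expR_ge0.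
(* The phases that the displacement might carry across a jump of [half_bit]. As [frac (2 x)] is
   uniform, their probability is at most [2 e n], which is summable. *)
pose B n : set R := [set x | 1 - 2 * e n <= frac (2 * x)].
have m2 : measurable_fun setT (fun x : R => frac (2 * x)).
  by apply: (measurableT_comp measurable_frac); exact: measurable_funM.
have mI n : measurable (`[1 - 2 * e n, +oo[%classic : set R) by exact: measurable_itv.
have mB n : measurable (B n).
  have := m2 measurableT _ (mI n); rewrite setTI; congr measurable.
  by apply/seteqP; split=> x /=; rewrite in_itv/= andbT.
have PB n : (P [set w : Omega | B n (w.2 n%:Z)] <= (2 * m%:R * expR (- 1) ^+ n)%:E)%E.
  rewrite circle_prob_coordinate//.
  have := unif_half_bit_double measurableT (mI n).
  rewrite /fair_bit (_ : [set x | setT (half_bit x)] = setT)// probability_setT mul1e.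
  rewrite (_ : [set x | _] = B n); last first.
    by apply/seteqP; split=> x /=; rewrite in_itv/= andbT; [case|].
  move=> ->; rewrite unifE//.
  apply: (@le_trans _ _ (lebesgue_measure (`[1 - 2 * e n, 1[%classic : set R))).
    apply: le_measure; rewrite ?inE//; first exact: measurableI.
    by move=> x [] /=; rewrite !in_itv/= andbT => -> /andP[_ ->].
  rewrite lebesgue_measure_itv/=; case: ifPn => _; last first.
    by rewrite lee_fin -mulrA mulr_ge0.
  by rewrite -EFinB lee_fin opprB addrCA subrr addr0 /e mulrA.
have mF n : measurable [set w : Omega | B n (w.2 n%:Z)].
  by have := measurable_phase n%:Z measurableT (mB n); rewrite setTI.
have BC := borel_cantelli_geometric e1 mF PB.
apply: filterS2 ae_octave01 BC => -[u z] /= /andP[u0 u1] [K HK].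
have [l hl] : exists l, two_sided_cvg (power_term m (u, z)) l; last by exists l.
(* Terms with large positive [k] vanish by Borel-Cantelli; those with [k = -n] are bounded by their
   amplitude [e^(H u) e^(-H n)]. *)
apply: (@two_sided_cvg_geometric _ _ (expR (- H)) (expR (H * u))).
- by rewrite expR_gt0 expR_lt1 oppr_lt0.
- exists K => n Kn; rewrite /power_term/=.
  rewrite half_bit_stable ?subrr ?mulr0//.
    by rewrite mulr_ge0// expR_ge0.
  have /negP := HK n Kn; rewrite -ltNge => h; apply: lt_le_trans h _.
  rewrite lerB// ler_pM2l// /e ler_wpM2l//.
  rewrite /frequency -expRM_natl ler_expR; lra.
- move=> n; rewrite /power_term/= normrM.
  have -> : `|amplitude (- n%:Z) u| = expR (H * u) * expR (- H) ^+ n.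
    rewrite ger0_norm ?expR_ge0// -expRM_natl -expRD /amplitude; congr expR.
    by rewrite intrN; ring.
  rewrite ler_piMr ?mulr_ge0 ?exprn_ge0 ?expR_ge0//.
  set a := half_bit _; set c := half_bit _.
  have := half_bit_ge0 (m%:R * frequency (- n%:Z) u + z (- n%:Z)).
  have := half_bit_le1 (m%:R * frequency (- n%:Z) u + z (- n%:Z)).
  have := half_bit_ge0 (z (- n%:Z)); have := half_bit_le1 (z (- n%:Z)).
  by rewrite -/a -/c ler_norml => *; lra.
Qed.

Definition phase_shift (t : int -> R -> R) (w : Omega) : Omega :=
  (w.1, relabel_rotate id (fun k => t k w.1) w.2).

Lemma phase_shift_preserving (t : int -> R -> R) :
  (forall k, measurable_fun setT (fun w : Omega => t k w.1)) ->
  preserving P (phase_shift t).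
Proof.
move=> mt; apply: (@skew_product_preserving _ _ _ _ id
  (fun u => relabel_rotate id (fun k => t k u))).
- by split=> //; exact: measurable_id.
- by move=> u; exact: relabel_rotate_preserving.
- apply: measurable_seqspace => k; apply: (measurableT_comp measurable_frac).
  by apply: measurable_funD.
Qed.

(** Multiplying frequencies by [n] subtracts [ln n] from [k + u]: the fractional part of [u - ln n]
    is the new [u], and its floor is absorbed by relabelling the octaves. *)
Definition dilation (n : nat) (w : Omega) : Omega :=
  (frac (w.1 - ln n%:R),
   relabel_rotate (fun k => k - Num.floor (w.1 - ln n%:R)) (fun=> 0) w.2).

Lemma dilation_preserving n : preserving P (dilation n).
Proof.
apply: (@skew_product_preserving _ _ _ _ (fun u => frac (u - ln n%:R))
  (fun u => relabel_rotate (fun k => k - Num.floor (u - ln n%:R)) (fun=> 0))).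
- exact: unif_preserving_rotate.
- by move=> u; apply: relabel_rotate_preserving; exact: subIr.
- apply: measurable_seqspace => k; apply: (measurableT_comp measurable_frac).
  apply: measurable_funD => // _ B mB; rewrite setTI.
  (* The octave that is read depends on [u] through a floor, so measurability is checked on each of
     its countably many values. *)
  have ms (s : int) : measurable [set w : Omega | Num.floor (w.1 - ln n%:R) = s].
    have m1 : measurable_fun setT (fun w : Omega => (Num.floor (w.1 - ln n%:R))%:~R : R).
      apply: (measurableT_comp measurable_floor).
      by apply: measurable_funB => //; exact: measurable_fst.
    have := m1 measurableT _ (measurable_set1 (s%:~R : R)); rewrite setTI.
    congr measurable; apply/seteqP; split=> w /=; [exact: intr_inj|by move=> ->].
  rewrite (_ : _ @^-1` _ = \bigcup_(s : int)
      ([set w : Omega | Num.floor (w.1 - ln n%:R) = s] `&` [set w : Omega | B (w.2 (k - s))])).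
    apply: countable_bigcupT_measurable => // s; apply: measurableI => //.
    by have := measurable_phase (k - s) measurableT mB; rewrite setTI.
  apply/seteqP; split=> w /=.
    by move=> Bw; exists (Num.floor (w.1 - ln n%:R)).
  by move=> [s _ [<-]].
Qed.

Lemma power_term_translate (j m : nat) (w : Omega) (k : int) :
  power_term m (phase_shift (fun k u => j%:R * frequency k u) w) k =
  power_term (m + j) w k - power_term j w k.
Proof.
rewrite /power_term /phase_shift /relabel_rotate/= half_bit_frac.
rewrite [m%:R * _ + frac _]addrC half_bit_fracD.
have -> : w.2 k + j%:R * frequency k w.1 + m%:R * frequency k w.1 =
    (m + j)%:R * frequency k w.1 + w.2 k by rewrite natrD; ring.
by rewrite [w.2 k + _]addrC; ring.
Qed.

Lemma power_term_dilate (n m : nat) (w : Omega) (k : int) : (0 < n)%N ->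
  power_term m (dilation n w) (k + Num.floor (w.1 - ln n%:R)) =
  (n%:R `^ H)^-1 * power_term (n * m) w k.
Proof.
move=> n0; set s := Num.floor (w.1 - ln n%:R).
have nR0 : 0 < n%:R :> R by rewrite ltr0n.
have E : (k + s)%:~R + frac (w.1 - ln n%:R) = k%:~R + w.1 - ln n%:R.
  by rewrite [in LHS]intrD -addrA [s%:~R + _]addrC -frac_eq addrA.
rewrite /power_term /dilation /relabel_rotate/= !half_bit_frac -/s addrK addr0.
rewrite [m%:R * _ + frac _]addrC half_bit_fracD [z in half_bit z]addrC.
have -> : frequency (k + s) (frac (w.1 - ln n%:R)) = n%:R * frequency k w.1.
  by rewrite /frequency E opprB expRD lnK ?posrE.
have -> : amplitude (k + s) (frac (w.1 - ln n%:R)) = (n%:R `^ H)^-1 * amplitude k w.1.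
  rewrite /amplitude E mulrBr expRD expRN mulrC /powR pnatr_eq0.
  by rewrite gtn_eqF.
by rewrite natrM [n%:R * m%:R]mulrC -!mulrA.
Qed.

Lemma power_process_dt_ss_si (b : nat -> R) :
  (forall n, (0 < n)%N -> b n = n%:R `^ H) -> dt_ss_si (P := P) power_process b.
Proof.
have mX m : measurable_fun setT (power_process m : Omega -> R).
  exact: measurable_power_process.
move=> bE; split=> [n n0|j j0].
  apply: eq_dist_process_sym.
  apply: (@preserving_eq_dist_process _ _ _ _ (dilation n)).
  - by move=> m; exact: measurable_funM.
  - by move=> m; exact: mX.
  - exact: dilation_preserving.
  apply: filterS power_term_ae_cvg => w cvw m /=.
  have [l hl] := cvw (n * m)%N; rewrite (power_processE hl).
  have bn0 : n%:R `^ H != 0 :> R by rewrite gt_eqF// powR_gt0// ltr0n.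
  set s := Num.floor (w.1 - ln n%:R).
  (* The dilated series is the rescaled one shifted by [s] octaves, which leaves the sum
     unchanged. *)
  have := two_sided_cvg_shift (- s) (two_sided_cvgZ (n%:R `^ H)^-1 hl).
  rewrite (_ : (fun k => _) = power_term m (dilation n w)); last first.
    by apply/funext => k; rewrite -power_term_dilate// subrK.
  by move=> h; rewrite (power_processE h) bE// mulVKf.
apply: (@preserving_eq_dist_process _ _ _ _ (phase_shift (fun k u => j%:R * frequency k u))).
- by move=> m; apply: measurable_funB; exact: mX.
- by move=> m; apply: measurable_funB; exact: mX.
- apply: phase_shift_preserving => k.
  by apply: measurable_funM => //; exact: measurable_frequency.
apply: filterS power_term_ae_cvg => w cvw m /=.
have E i : power_process i (phase_shift (fun k u => j%:R * frequency k u) w)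
    = power_process (i + j) w - power_process j w.
  have [l1 h1] := cvw (i + j)%N; have [l2 h2] := cvw j.
  rewrite (power_processE h1) (power_processE h2); apply: power_processE.
  have := two_sided_cvgB h1 h2; congr (two_sided_cvg _ _).
  by apply/funext => k; rewrite power_term_translate.
by rewrite !E addSn opprB addrA subrK.
Qed.

Lemma power_process_nontrivial : nontrivial (P := P) power_process.
Proof.
(* A half turn of the phase of octave 1 reverses the sign of its term and fixes all others. *)
pose t (k : int) (u : R) : R := if k == 1 then 2^-1 else 0.
(* From a phase in [[a, 1/2)], a displacement between [e^(-2)] and [e^(-1) <= 1/2] passes 1/2 and
   stays below 1, so the term of octave 1 is nonzero. *)
pose a : R := 2^-1 - expR (- 2).
pose B : set R := `[a, 2^-1[%classic.
have mB : measurable B by exact: measurable_itv.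
have e2 : 2 <= expR 1 :> R by have := expR_ge1Dx (1 : R); lra.
have e1 : expR (- 1) <= 2^-1 :> R by rewrite expRN lef_pV2 ?posrE// expR_gt0.
have e2e1 : expR (- 2) < expR (- 1) :> R by rewrite ltr_expR; lra.
apply: (@preserving_nontrivial _ _ _ _ (phase_shift t) _ 1%N [set w : Omega | B (w.2 1)]).
- by apply: phase_shift_preserving => k; exact: measurable_cst.
- by have := measurable_phase 1 measurableT mB; rewrite setTI.
- rewrite circle_prob_coordinate// unifE// (_ : B `&` _ = B); last first.
    by apply/setIidPl => x; rewrite /B /a/= !in_itv/=; lra.
  rewrite lebesgue_measure_itv/= lte_fin ifT; last by rewrite gtrBl expR_gt0.
  by rewrite -EFinB eqe /a subKr gt_eqF// expR_gt0.
apply: filterS2 ae_octave01 power_term_ae_cvg => w /andP[u0 u1] cvw Bw E.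
have [l hl] := cvw 1%N.
pose c : R := - 2 * power_term 1 w 1.
have h : two_sided_cvg (power_term 1 (phase_shift t w)) (l + c).
  have := two_sided_cvgB hl (two_sided_cvg_single (- c)); rewrite opprK.
  congr (two_sided_cvg _ _); apply/funext => k.
  rewrite /power_term /phase_shift /relabel_rotate/= half_bit_frac.
  rewrite [_ * frequency k w.1 + frac _]addrC half_bit_fracD /t.
  have [->|_] := eqVneq k 1; last by rewrite !addr0 subr0 [w.2 k + _]addrC.
  rewrite [w.2 1 + _ + _]addrAC !half_bitD_half /c /power_term [w.2 1 + _]addrC /=; ring.
move: E; rewrite /= (power_processE h) (power_processE hl).
suff c0 : c != 0 by move/eqP; rewrite addrC -subr_eq0 addrK (negbTE c0).
rewrite /c mulf_neq0// ?oppr_eq0// /power_term mulf_neq0 ?gt_eqF ?expR_gt0//.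
move: Bw; rewrite /B/= in_itv/= /a => /andP[z0 z1].
have f1 : frequency 1 w.1 <= expR (- 1) by rewrite ler_expR mulr1z; lra.
have f2 : expR (- 2) <= frequency 1 w.1 by rewrite ler_expR mulr1z; lra.
rewrite (half_bit_lo (x := w.2 1)); last by apply/andP; split; lra.
by rewrite half_bit_hi ?subr0 ?oner_neq0// mul1r; apply/andP; split; lra.
Qed.

End PowerProcess.

(** * The constant process and the assembly of the theorem *)

Lemma constant_process_dt_ss_si (R : realType) (b : nat -> R) : scaling_one b ->
  dt_ss_si (P := @unif R) (fun _ => cst 1) b /\
  nontrivial (P := @unif R) (fun _ => cst 1).
Proof.
move=> b1; split.
  split=> [n n0 A _|k k0 A _].
    by congr (_ _); apply/funext => w /=; rewrite b1// mulr1.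
  by [].
move=> [N [mN N0 XN]].
have : @unif R setT = 0%E.
  apply/eqP; rewrite -measure_le0 -N0; apply: le_measure; rewrite ?inE// => w _.
  by apply: XN => /(_ 0%N) /= E; move: (oner_neq0 R); rewrite -E eqxx.
by rewrite probability_setT => /eqP; rewrite eqe oner_eq0.
Qed.

(* The middle conjunct is the "in other words" reformulation of (2). *)
Theorem theorem3p3 (R : realType) :
  (forall (tau : nat) (d : measure_display) (T : measurableType d)
          (P : probability T R) (X : nat -> {RV P >-> R}) (b : nat -> R),
     (0 < tau)%N -> positive_valued b -> dt_ss_csi X tau b ->
     nondegenerate (X 1%N) ->
     [\/ scaling_one b, scaling_padic b | scaling_power b])
  /\
  (forall (b : nat -> R) (p : nat),
     positive_valued b -> completely_multiplicative b -> prime p ->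
     (padic_scaling b p <->
      b p < 1 /\ (forall q : nat, prime q -> q <> p -> b q = 1)))
  /\
  (forall b : nat -> R,
     positive_valued b -> completely_multiplicative b ->
     [\/ scaling_one b, scaling_padic b | scaling_power b] ->
     exists (d : measure_display) (T : measurableType d)
            (P : probability T R) (X : nat -> {RV P >-> R}),
       dt_ss_si X b /\ nontrivial X).
Proof.
split; first by move=> tau d T P X b; exact: dt_ss_csi_trichotomy.
split; first by move=> b p; exact: padic_scalingP.
move=> b b0 bM [b1|[p [[pp [H [H0 bE]]] _]]|[H [H0 bE]]].
- by do 4!eexists; exact: constant_process_dt_ss_si.
- have p1 : 1 < p%:R :> R by rewrite ltr1n prime_gt1.
  have p0 : 0 < p%:R :> R by exact: lt_trans p1.
  pose r : R := p%:R^-1 `^ H.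
  have r01 : 0 < r < 1.
    rewrite powR_gt0 ?invr_gt0//= /r /powR invr_eq0 gt_eqF// expR_lt1.
    by rewrite lnV ?posrE// mulrN oppr_lt0 mulr_gt0// ln_gt0.
  do 4!eexists; split; last exact: (padic_process_nontrivial pp r01).
  by apply: (padic_process_dt_ss_si pp r01) => n n0; rewrite bE// padic_norm_powR.
- do 4!eexists; split; last exact: (power_process_nontrivial H0).
  exact: (power_process_dt_ss_si H0 bE).
Qed.
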